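(* Let $d\ge1$, $n\ge1$ be integers and let $A$ be a real $n\times d$ matrix with rows $\vec\alpha_1,\dots,\vec\alpha_n$ which is badly approximable with approximation constant $C_A>0$. Let $Q=\frac{1}{2n}\sum_{i=1}^n(\delta_{\vec\alpha_i}+\delta_{-\vec\alpha_i})$ be the probability measure on $\mathbb{T}^d=\mathbb{R}^d/\mathbb{Z}^d$ generating the random walk (each row $\vec\alpha_i$ taken mod 1). Then for every positive integer $k$, $$D(Q^{*k})\ \le\ \left(\frac{3}{2}\right)^d\, 20\,\left(\frac{n}{C_A\sqrt{2}}\right)^{n/d} k^{-n/2d}.$$
   Context: For $x\in\mathbb{R}^m$, $\|x\|_\infty$ is the supremum norm and $\{x\}_\infty$ is the supremum-norm distance from $x$ to the nearest point of $\mathbb{Z}^m$. An $n\times d$ real matrix $A$ is called badly approximable if there exists a constant $C_A>0$ (called an approximation constant of $A$) such that $\{A\mathbf{h}\}_\infty > C_A/\|\mathbf{h}\|_\infty^{d/n}$ for all nonzero $\mathbf{h}\in\mathbb{Z}^d$. $Q^{*k}$ is the $k$-fold convolution of $Q$ on the additive group $\mathbb{T}^d$, i.e. the distribution after $k$ steps of the random walk started at $\vec 0$ that at each step picks a row $\vec\alpha_i$ uniformly at random and adds or subtracts it (each with probability $1/2$) mod 1. Let $U$ be Haar (uniform) measure on $\mathbb{T}^d$. A box is a set $[a_1,b_1)\times\cdots\times[a_d,b_d)\subseteq\mathbb{T}^d$ with sides parallel to the axes, and the discrepancy of a probability measure $P$ is $D(P)=\sup_{B\text{ box}}|P(B)-U(B)|$.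 *)

(* Defs.v *)
From HB Require Import structures.
From mathcomp Require Import all_boot all_order all_algebra.
From mathcomp Require Import reals exp.
Set Implicit Arguments. Unset Strict Implicit. Unset Printing Implicit Defensive.
Import Order.TTheory GRing.Theory Num.Theory.
Local Open Scope ring_scope.

Section Defs.
Variable R : realType.

Definition fracR (x : R) : R := x - (Num.floor x)%:~R.

Definition distZ (x : R) : R :=
  Num.min (x - (Num.floor x)%:~R) ((Num.floor x)%:~R + 1 - x).

Definition distZv (m : nat) (x : 'I_m -> R) : R :=
  \big[Num.max/0]_(i < m) distZ (x i).

Definition supnormZ (m : nat) (h : 'I_m -> int) : R :=
  \big[Num.max/0]_(i < m) `|(h i)%:~R : R|.

Definition matvecZ (n d : nat) (A : 'M[R]_(n, d)) (h : 'I_d -> int) : 'I_n -> R :=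
  fun i => \sum_(j < d) A i j * (h j)%:~R.

Definition approx_const (n d : nat) (A : 'M[R]_(n, d)) (C : R) : Prop :=
  0 < C /\
  forall h : 'I_d -> int, (exists j, h j != 0) ->
    distZv (matvecZ A h) > C / powR (supnormZ h) (d%:R / n%:R).

(* A box [a_1,b_1) x ... x [a_d,b_d) in T^d, identified with [0,1)^d,
   with 0 <= a_l <= b_l <= 1. *)
Definition is_box (d : nat) (a b : 'I_d -> R) : Prop :=
  forall l, 0 <= a l /\ a l <= b l /\ b l <= 1.

Definition in_box (d : nat) (a b : 'I_d -> R) (x : 'I_d -> R) : bool :=
  [forall l, (a l <= fracR (x l)) && (fracR (x l) < b l)].

Definition haar_box (d : nat) (a b : 'I_d -> R) : R := \prod_(l < d) (b l - a l).

Definition walk_point (n d k : nat) (A : 'M[R]_(n, d))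
    (w : {ffun 'I_k -> 'I_n * bool}) : 'I_d -> R :=
  fun l => \sum_(j < k) (if (w j).2 then A (w j).1 l else - A (w j).1 l).

(* Q^{*k}(B): the k-fold convolution of Q = (1/2n) sum_i (delta_{alpha_i} + delta_{-alpha_i})
   evaluated on the box B, i.e. the probability that the k-step walk
   (uniform over the (2n)^k equally likely step sequences) ends in B. *)
Definition Qconv_box (n d k : nat) (A : 'M[R]_(n, d)) (a b : 'I_d -> R) : R :=
  (#|[set w : {ffun 'I_k -> 'I_n * bool} | in_box a b (walk_point A w)]|)%:R
  / ((2 * n) ^ k)%:R.

End Defs.

(* Main.v *)
Require Import Defs.
From HB Require Import structures.
From mathcomp Require Import all_boot all_order all_algebra.
From mathcomp Require Import ring lra zify.
From mathcomp Require Import complex.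
From mathcomp Require Import boolp classical_sets functions reals topology.
From mathcomp Require Import normedtype sequences derive realfun exp trigo.
Set Implicit Arguments. Unset Strict Implicit. Unset Printing Implicit Defensive.
Import Order.TTheory GRing.Theory Num.Theory numFieldNormedType.Exports.
Import ComplexField.Normc.
Local Open Scope ring_scope.

(** The indicator of each side of a box is smoothed by convolution with a
Jackson kernel of degree at most [K]: if [Psi] is the primitive of the kernel,
with [Psi (v + 1) = Psi v + 1], then [Psi (x - a) - Psi (x - b)] is a
trigonometric polynomial with values in [[0, 1]], whose distance to the
indicator of [[a, b)] is at most [E (x - a) + E (x - b)], where [E] is a sum of
shifted Fejer kernels of mean [2 / (K + 1)]. Averaging over the walk, the
discrepancy is at most
[d * (4 / (K + 1)) * (1 + sum_h |Q^(h)|^k) + sum_h |Q^(h)|^k / |h|], where both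
sums are over [0 < |h| <= K].

The Fourier coefficient of one step is [Q^(h) = (1/n) sum_i cos (2 pi (Ah)_i)],
so that [|Q^(h)|^k] is at most the exponential of [-(4k/n)] times the squared
distance of [2Ah] to [Z^n]. Let [X] be the bound without its factor
[20 (3/2)^d], and [K] the integer part of [1 / (4X)]. Since [A] is badly
approximable, the points [2Ah] with [|h| <= K] are separated mod 1 by
[s = n / sqrt (2k)], hence each cube of side [s] of a fixed orthant contains at
most one of them, and the sums over [h] are dominated by a product of geometric
series of ratio [exp (-3n/2)]. The approximation property also gives
[1 / |h| <= 2X u^(n/d)] with [u] the distance of [2Ah] to [Z^n] divided by [s],
which the exponential absorbs. *)

(** * Elementary inequalities for sine and cosine *)

Section Trigonometry.
Variable R : realType.
Implicit Types x t v z w : R.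

Lemma MVT_everywhere (f df : R -> R) (a b : R) : a < b ->
  (forall x, a <= x <= b -> is_derive x 1 f (df x)) ->
  exists2 c, a < c < b & f b - f a = df c * (b - a).
Proof.
move=> ab dfE; have [|||c] := @MVT R f df a b => //.
- by move=> x; rewrite in_itv /= => /andP[ax xb]; apply: dfE; rewrite !ltW.
- apply: derivable_within_continuous => x; rewrite in_itv /= => /dfE.
  by case.
- by rewrite in_itv /= => cab; exists c.
Qed.

Lemma ler_of_derive_ge0 (f df : R -> R) (a b : R) : a <= b ->
  (forall x, a <= x <= b -> is_derive x 1 f (df x)) ->
  (forall x, a < x < b -> 0 <= df x) -> f a <= f b.
Proof.
rewrite le_eqVlt => /predU1P[-> //|ab] dfE df0.
have [c cab E] := MVT_everywhere ab dfE.
by rewrite -subr_ge0 E mulr_ge0 ?df0 // subr_ge0 ltW.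
Qed.

Lemma sin_lex x : 0 <= x -> sin x <= x.
Proof.
move=> x0; have : 0 - sin 0 <= x - sin x.
  apply: (@ler_of_derive_ge0 (fun y => y - sin y) (fun y => 1 - cos y)) => // y _.
  by rewrite subr_ge0 cos_le1.
by rewrite sin0; lra.
Qed.

(* The mean value theorem on [0, z] and on [z, w], since [cos] decreases on [0, pi]. *)
Lemma sin_chord z w : 0 <= z <= w -> w <= pi -> z * sin w <= w * sin z.
Proof.
case/andP=> z0 zw wpi.
have [->|zN0] := eqVneq z 0; first by rewrite sin0 mul0r mulr0.
have [<-//|zNw] := eqVneq z w.
have {}z0 : 0 < z by rewrite lt_def zN0.
have {}zw : z < w by rewrite lt_neqAle zNw.
have [c /andP[c0 cz] Ec] := @MVT_everywhere sin cos 0 z z0 (fun x _ => is_derive_sin x).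
have [e /andP[ez ew] Ee] := @MVT_everywhere sin cos z w zw (fun x _ => is_derive_sin x).
rewrite sin0 !subr0 in Ec.
have : cos e < cos c.
  by rewrite ltr_cos ?in_itv /= ?(lt_trans cz) //; apply/andP; split; lra.
move=> ec; have -> : sin w = sin z + cos e * (w - z) by lra.
rewrite Ec -subr_ge0.
have -> : w * (cos c * z) - z * (cos c * z + cos e * (w - z)) =
  z * (w - z) * (cos c - cos e) by ring.
by apply/ltW; rewrite !mulr_gt0 ?subr_gt0.
Qed.

(** The triple angle formula at [pi / 6] gives a cubic equation for [s] that factors as
    [(s + 1) * (2 * s - 1) ^+ 2 = 0], and [s] is positive. *)
Lemma sin_pi_sixth : sin (pi / 6) = 2^-1 :> R.
Proof.
have p0 := @pi_gt0 R.
set s := sin _.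
have s0 : 0 < s by apply: sin_gt0_pi; apply/andP; split; lra.
have E : 3 * s - 4 * s ^+ 3 = 1.
  rewrite -[RHS](@sin_pihalf R).
  have -> : pi / 2 = pi / 6 + (pi / 6) *+ 2 :> R by lra.
  rewrite sinD sin_mulr2n cos_mulr2n -/s.
  have := cos2Dsin2 (pi / 6 : R); rewrite -/s => cs.
  have c2 : cos (pi / 6 : R) ^+ 2 = 1 - s ^+ 2 by lra.
  rewrite !mulr2n.
  transitivity (s * (2 * cos (pi / 6) ^+ 2 - 1) + 2 * s * cos (pi / 6) ^+ 2); last ring.
  by rewrite c2; ring.
have : (s + 1) * (2 * s - 1) ^+ 2 = 0.
  have -> : (s + 1) * (2 * s - 1) ^+ 2 = 1 - (3 * s - 4 * s ^+ 3) by ring.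
  by rewrite E subrr.
move/eqP; rewrite mulf_eq0 expf_eq0 /= => /orP[] /eqP; lra.
Qed.

Lemma pi_ge3 : 3 <= pi :> R.
Proof.
have p0 := @pi_gt0 R.
have /sin_lex : 0 <= pi / 6 :> R by lra.
rewrite sin_pi_sixth; lra.
Qed.

Lemma sin2_pi_fourth : sin (pi / 4) ^+ 2 = 2^-1 :> R.
Proof.
have := @cos_pihalf R.
have -> : pi / 2 = (pi / 4) *+ 2 :> R by lra.
rewrite cos_mulr2n cos2sin2; lra.
Qed.

Lemma sin_pi_fourth_chord z : 0 <= z <= pi / 4 -> z ^+ 2 / 2 <= (pi / 4) ^+ 2 * sin z ^+ 2.
Proof.
move=> /[dup] z04 /andP[z0 z4]; have p0 := @pi_gt0 R.
have := sin_chord z04; rewrite -!exprMn -sin2_pi_fourth => H.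
rewrite -exprMn ler_sqr ?nnegrE; first by apply: H; lra.
  by apply: mulr_ge0 => //; apply: sin_ge0_pi; apply/andP; split; lra.
by apply: mulr_ge0; [lra|]; apply: sin_ge0_pi; apply/andP; split; lra.
Qed.

(** Since [cos (pi t) = 1 - 2 sin^2 (pi t / 2)] and [pi t / 2] lies in [[0, pi / 4]] for [t >= 0],
    the chord inequality there gives [sin^2 (pi t / 2) >= 2 t^2]. Equality holds at [t = 0] and
    [|t| = 1/2]. *)
Lemma cos_pi_quad t : `|t| <= 2^-1 -> cos (pi * t) <= 1 - 4 * t ^+ 2.
Proof.
wlog t0 : t / 0 <= t.
  move=> W; have [/W//|/ltW tn] := leP 0 t.
  by rewrite -normrN => /W; rewrite sqrrN mulrN cosN => -> //; rewrite oppr_ge0.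
rewrite ger0_norm // => t2; have p0 := @pi_gt0 R.
have -> : pi * t = (pi * t / 2) *+ 2 by lra.
rewrite cos_mulr2n cos2sin2.
have z0 : 0 <= pi * t / 2 by rewrite divr_ge0 // mulr_ge0 // ltW.
have := @sin_pi_fourth_chord (pi * t / 2); set S := sin _ ^+ 2.
have z4 : pi * t / 2 <= pi / 4 by nra.
move=> /(_ (introT andP (conj z0 z4))) H.
suff : 2 * t ^+ 2 <= S by lra.
rewrite -(@ler_pM2l _ ((pi / 4) ^+ 2)) ?exprn_gt0 ?divr_gt0 //.
apply: le_trans H; rewrite le_eqVlt; apply/orP; left; apply/eqP; by field.
Qed.

Lemma sin2_le1 x : sin x ^+ 2 <= 1.
Proof. by rewrite sin2cos2 gerBl sqr_ge0. Qed.

End Trigonometry.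

(** * Complex exponentials and the Fejer kernel *)

Section Characters.
Variable R : realType.
Implicit Types (x v : R).
Local Open Scope complex_scope.

Lemma normc_sqr (z : R[i]) : normc z ^+ 2 = complex.Re z ^+ 2 + complex.Im z ^+ 2.
Proof. by case: z => a b /=; rewrite sqr_sqrtr // addr_ge0 ?sqr_ge0. Qed.

Lemma normc_ge0 (z : R[i]) : 0 <= normc z.
Proof. by case: z => a b; rewrite sqrtr_ge0. Qed.

Lemma normcR x : normc x%:C = `|x|.
Proof. by rewrite /= expr0n addr0 sqrtr_sqr. Qed.

Lemma normc_sum (I : Type) (r : seq I) (P : pred I) (F : I -> R[i]) :
  normc (\sum_(i <- r | P i) F i) <= \sum_(i <- r | P i) normc (F i).
Proof.
elim/big_ind2: _ => [|x y z t xy zt|//]; first by rewrite normc0.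
by apply: le_trans (le_normcD _ _) _; rewrite lerD.
Qed.

Lemma normc_prod (I : Type) (r : seq I) (P : pred I) (F : I -> R[i]) :
  normc (\prod_(i <- r | P i) F i) = \prod_(i <- r | P i) normc (F i).
Proof.
elim/big_rec2: _ => [|i x y _ <-]; last by rewrite normcM.
by rewrite /= expr0n expr1n addr0 sqrtr1.
Qed.

Lemma Re_sum (I : Type) (r : seq I) (P : pred I) (F : I -> R[i]) :
  complex.Re (\sum_(i <- r | P i) F i) = \sum_(i <- r | P i) complex.Re (F i).
Proof. by apply: (big_morph (@complex.Re R)) => // -[a b] [c d]. Qed.

Lemma Im_sum (I : Type) (r : seq I) (P : pred I) (F : I -> R[i]) :
  complex.Im (\sum_(i <- r | P i) F i) = \sum_(i <- r | P i) complex.Im (F i).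
Proof. by apply: (big_morph (@complex.Im R)) => // -[a b] [c d]. Qed.

Definition cis x : R[i] := cos (2 * pi * x) +i* sin (2 * pi * x).

Lemma cisD x v : cis (x + v) = cis x * cis v.
Proof.
rewrite /cis mulrDr cosD sinD; apply/eqP; rewrite eq_complex /= eqxx /=.
by rewrite addrC.
Qed.

Lemma cis0 : cis 0 = 1.
Proof. by rewrite /cis mulr0 cos0 sin0. Qed.

Lemma normc_cis x : normc (cis x) = 1.
Proof. by rewrite /= cos2Dsin2 sqrtr1. Qed.

Lemma cis_sum (I : Type) (r : seq I) (P : pred I) (F : I -> R) :
  cis (\sum_(i <- r | P i) F i) = \prod_(i <- r | P i) cis (F i).
Proof. by apply: (big_morph cis cisD cis0). Qed.

Lemma cisMn n x : cis (n%:R * x) = cis x ^+ n.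
Proof. by elim: n => [|n IHn]; rewrite ?mul0r ?cis0 // -natr1 mulrDl mul1r cisD IHn exprSr. Qed.

Lemma normc_1Bcis_sqr x : normc (1 - cis x) ^+ 2 = 4 * sin (pi * x) ^+ 2.
Proof.
rewrite normc_sqr /= /cis.
have -> : 2 * pi * x = (pi * x) *+ 2 :> R by ring.
rewrite cos_mulr2n sin_mulr2n.
have := cos2Dsin2 (pi * x); set s := sin _; set c := cos _ => cs.
transitivity (4 * s ^+ 2 + 4 * (1 - c ^+ 2) * (1 - (c ^+ 2 + s ^+ 2))); first by ring.
by rewrite cs subrr mulr0 addr0.
Qed.

Lemma sin_int (m : int) : sin (pi * m%:~R) = 0 :> R.
Proof.
have nat_case (n : nat) : sin (pi * n%:R) = 0 :> R.
  elim: n => [|n IHn]; first by rewrite mulr0 sin0.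
  by rewrite -natr1 mulrDr mulr1 sinDpi IHn oppr0.
by case: m => n; rewrite ?NegzE ?mulrNz ?mulrN ?sinN -?pmulrn nat_case ?oppr0.
Qed.

Lemma cis_int (m : int) : cis m%:~R = 1.
Proof.
have := normc_1Bcis_sqr m%:~R; rewrite sin_int expr0n mulr0 => /eqP.
by rewrite expf_eq0 => /andP[_] /eqP/(@eq0_normc R)/eqP; rewrite subr_eq0 => /eqP.
Qed.

Lemma cisD_int x (m : int) : cis (x + m%:~R) = cis x.
Proof. by rewrite cisD cis_int mulr1. Qed.

(** Both the Fejer and the Jackson kernel are defined by the double cosine sum; this identity makes
    them squared moduli, hence nonnegative. *)
Lemma autocorrelation n (c : 'I_n -> R) v :
  \sum_p \sum_q c p * c q * cos (2 * pi * ((p%:R - q%:R) * v)) =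
  normc (\sum_p (c p)%:C * cis (p%:R * v)) ^+ 2.
Proof.
have Re_eq p : complex.Re ((c p)%:C * cis (p%:R * v)) = c p * cos (2 * pi * (p%:R * v)).
  by rewrite /= mul0r subr0.
have Im_eq p : complex.Im ((c p)%:C * cis (p%:R * v)) = c p * sin (2 * pi * (p%:R * v)).
  by rewrite /= mul0r addr0.
rewrite normc_sqr Re_sum Im_sum (eq_bigr _ (fun p _ => Re_eq p)) (eq_bigr _ (fun p _ => Im_eq p)).
rewrite !expr2 !mulr_suml -big_split; apply: eq_bigr => p _ /=.
rewrite !mulr_sumr -big_split; apply: eq_bigr => q _ /=.
by rewrite mulrBl mulrBr cosB; ring.
Qed.

Lemma geometric_cis n v :
  (1 - cis v) * (\sum_(p < n) cis (p%:R * v)) = 1 - cis (n%:R * v).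
Proof.
under eq_bigr => p _ do rewrite cisMn.
by rewrite cisMn -opprB -[RHS]opprB subrX1 mulNr.
Qed.

(** The normalisation gives value 1 at 0, hence mean [1 / N], coming from the terms [p = q]. *)
Definition fejer (N : nat) v : R :=
  (\sum_(p < N) \sum_(q < N) cos (2 * pi * ((p%:R - q%:R) * v))) / N%:R ^+ 2.

Lemma fejerE N v :
  fejer N v = normc (\sum_(p < N) cis (p%:R * v)) ^+ 2 / N%:R ^+ 2.
Proof.
rewrite /fejer; congr (_ / _).
have := @autocorrelation N (fun=> 1) v.
under eq_bigr do under eq_bigr do rewrite !mul1r.
move=> ->; congr (normc _ ^+ 2).
by apply: eq_bigr => p _; rewrite [_%:C]rmorph1 mul1r.
Qed.

Lemma fejer_ge0 N v : 0 <= fejer N v.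
Proof. by rewrite fejerE divr_ge0 // sqr_ge0. Qed.

(** The denominator is cleared so that the identity also holds where [sin (pi * v)] vanishes. *)
Lemma fejer_closed N v : (0 < N)%N ->
  fejer N v * (N%:R * sin (pi * v)) ^+ 2 = sin (pi * (N%:R * v)) ^+ 2.
Proof.
move=> N0; have NR : N%:R != 0 :> R by rewrite pnatr_eq0 -lt0n.
rewrite fejerE exprMn [LHS]mulrA divfK ?expf_neq0 //.
have : 4 * sin (pi * v) ^+ 2 * normc (\sum_(p < N) cis (p%:R * v)) ^+ 2 = 4 * sin (pi * (N%:R * v)) ^+ 2.
  by rewrite -!normc_1Bcis_sqr -exprMn -normcM geometric_cis.
by move=> H; nra.
Qed.

Lemma fejer0 N : (0 < N)%N -> fejer N 0 = 1.
Proof.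
move=> N0; have NR : N%:R != 0 :> R by rewrite pnatr_eq0 -lt0n.
rewrite fejerE; under eq_bigr do rewrite mulr0 cis0.
rewrite sumr_const card_ord -[1]/(1%:C) -(rmorphMn (real_complex R)) normcR.
by rewrite ger0_norm // divff // expf_neq0.
Qed.

Lemma fejerN N v : fejer N (- v) = fejer N v.
Proof.
congr (_ / _); apply: eq_bigr => p _; apply: eq_bigr => q _.
by rewrite !mulrN cosN.
Qed.

Lemma fejerD1 N v : fejer N (v + 1) = fejer N v.
Proof.
rewrite !fejerE; congr (normc _ ^+ 2 / _); apply: eq_bigr => p _.
by rewrite mulrDr mulr1 -[p%:R in X in cis (_ + X)]/((p%:Z)%:~R) cisD_int.
Qed.

End Characters.

(** * Smoothing kernels and their primitives *)

Section Sawtooth.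
Variable R : realType.
Implicit Types (x v : R).

Lemma is_derive_bigsum (I : Type) (r : seq I) (F dF : I -> R -> R) x :
  (forall i, is_derive x 1 (F i) (dF i x)) ->
  is_derive x 1 (fun y => \sum_(i <- r) F i y) (\sum_(i <- r) dF i x).
Proof.
move=> FE; elim: r => [|i r IHr].
  rewrite big_nil; have -> : (fun y => \sum_(i <- [::]) F i y) = cst 0.
    by apply/funext => y; rewrite big_nil.
  exact: is_derive_cst.
rewrite big_cons.
have -> : (fun y => \sum_(i <- i :: r) F i y) = F i \+ (fun y => \sum_(i <- r) F i y).
  by apply/funext => y; rewrite big_cons.
exact: is_deriveD.
Qed.

(* The case [m = 0] is separate, because [x / 0 = 0]. *)
Definition cos_primitive (m v : R) :=
  if m == 0 then v else sin (2 * pi * (m * v)) / (2 * pi * m).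

Lemma is_derive_cos_primitive m x :
  is_derive x 1 (cos_primitive m) (cos (2 * pi * (m * x))).
Proof.
rewrite /cos_primitive; case: eqP => [->|/eqP m0].
  by rewrite mul0r mulr0 cos0; exact: is_derive_id.
have p0 : 2 * pi * m != 0 by rewrite !mulf_eq0 pnatr_eq0 (negbTE m0) (gt_eqF (pi_gt0 R)).
have lin : is_derive x 1 (fun v => 2 * pi * (m * v)) (2 * pi * m).
  have -> : (fun v => 2 * pi * (m * v)) = (fun v => (2 * pi * m) *: v).
    by apply/funext => v; rewrite mulrA.
  by apply: is_derive_eq; rewrite [_ *: _]mulr1.
have -> : (fun v => sin (2 * pi * (m * v)) / (2 * pi * m)) =
   (2 * pi * m)^-1 \*: (sin \o (fun v => 2 * pi * (m * v))).
  by apply/funext => v; rewrite mulrC.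
apply: is_derive_eq.
by rewrite [_ *: _]mulrCA mulVf // mulr1.
Qed.

(* Stated for variables, because [field] would unfold [pi]. *)
Lemma cot_primitive_identity (C S P z : R) : S != 0 -> P != 0 -> z != 0 ->
  - (P * z)^-1 * (- P / S ^+ 2 + 3^-1 * (3 * (C / S) ^+ 2 * (- P / S ^+ 2))) =
  (C ^+ 2 + S ^+ 2) / S ^+ 4 / z.
Proof. by move=> S0 P0 z0; field; apply/and3P. Qed.

Section Smoothing.
Variables (n : nat) (c : 'I_n -> R).
Hypothesis c_energy : 0 < \sum_p c p ^+ 2.
Let Z := \sum_p c p ^+ 2.

(** Dividing by [Z] makes the mean 1, since only the terms [p = q] have nonzero mean. *)
Definition smoothing_density v :=
  (\sum_p \sum_q c p * c q * cos (2 * pi * ((p%:R - q%:R) * v))) / Z.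

Definition smoothing_cdf v :=
  (\sum_p \sum_q c p * c q * cos_primitive (p%:R - q%:R) v) / Z.

Lemma is_derive_smoothing_cdf x : is_derive x 1 smoothing_cdf (smoothing_density x).
Proof.
have -> : smoothing_cdf = Z^-1 \*:
    (fun v => \sum_p \sum_q c p * c q * cos_primitive (p%:R - q%:R) v).
  by apply/funext => v; rewrite /smoothing_cdf mulrC.
have H : is_derive x 1 (fun v => \sum_p \sum_q c p * c q * cos_primitive (p%:R - q%:R) v)
  (\sum_p \sum_q c p * c q * cos (2 * pi * ((p%:R - q%:R) * x))).
  apply: (@is_derive_bigsum _ _ _ (fun p x => \sum_q c p * c q * cos (2 * pi * ((p%:R - q%:R) * x)))) => p.
  apply: (@is_derive_bigsum _ _ _ (fun q x => c p * c q * cos (2 * pi * ((p%:R - q%:R) * x)))) => q.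
  have H := is_derive_cos_primitive (p%:R - q%:R) x.
  exact: is_deriveZ.
by apply: is_derive_eq; rewrite /smoothing_density [LHS]mulrC.
Qed.

Lemma smoothing_densityE v : smoothing_density v =
  normc (\sum_p (real_complex R (c p)) * cis (p%:R * v)) ^+ 2 / Z.
Proof. by rewrite /smoothing_density autocorrelation. Qed.

Lemma smoothing_density_ge0 v : 0 <= smoothing_density v.
Proof. by rewrite smoothing_densityE divr_ge0 ?sqr_ge0 ?ltW. Qed.

Lemma smoothing_cdf_le x v : x <= v -> smoothing_cdf x <= smoothing_cdf v.
Proof.
move=> xv; apply: ler_of_derive_ge0 xv (fun y _ => is_derive_smoothing_cdf y) _ => y _.
exact: smoothing_density_ge0.
Qed.

Lemma smoothing_cdfN v : smoothing_cdf (- v) = - smoothing_cdf v.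
Proof.
rewrite /smoothing_cdf -mulNr -sumrN; congr (_ / _); apply: eq_bigr => p _.
rewrite -sumrN; apply: eq_bigr => q _.
rewrite -mulrN; congr (_ * _); rewrite /cos_primitive; case: ifP => // _.
by rewrite !mulrN sinN mulNr.
Qed.

(** The terms [p = q] add up to [v]; the others are sines of integer frequency. *)
Lemma smoothing_cdfD1 v : smoothing_cdf (v + 1) = smoothing_cdf v + 1.
Proof.
have ZN0 : Z != 0 by rewrite gt_eqF.
apply: (mulIf ZN0); rewrite /smoothing_cdf mulrDl mul1r !divfK //.
rewrite -big_split; apply: eq_bigr => p _ /=.
rewrite [in RHS](bigD1 p) //= [in LHS](bigD1 p) //=.
rewrite /cos_primitive subrr eqxx.
rewrite addrAC mulrDr mulr1 expr2; congr (_ + _).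
apply: eq_bigr => q qp; congr (_ * _); rewrite subr_eq0 eqr_nat.
rewrite ifN; last by apply: contraNneq qp => E; exact/eqP/val_inj/esym.
rewrite ifN; last by apply: contraNneq qp => E; exact/eqP/val_inj/esym.
congr (_ / _).
have := cisD_int ((p%:R - q%:R) * v) (p%:Z - q%:Z).
by rewrite rmorphB /= -!pmulrn => -[_ E]; rewrite [_ * (v + 1)]mulrDr mulr1 E.
Qed.

Lemma smoothing_cdf_half : smoothing_cdf 2^-1 = 2^-1.
Proof.
have := smoothing_cdfD1 (- 2^-1); rewrite smoothing_cdfN.
have -> : - 2^-1 + 1 = 2^-1 :> R by lra.
lra.
Qed.

(* The density is compared with [sin^-4], whose primitive is [-(cot + cot^3 / 3) / pi]. *)
Lemma smoothing_cdf_tail v : 0 < v <= 2^-1 ->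
  (forall y, sin (pi * y) ^+ 4 * (smoothing_density y * Z) <= 1) ->
  2^-1 - smoothing_cdf v <=
    (cos (pi * v) / sin (pi * v) + (cos (pi * v) / sin (pi * v)) ^+ 3 / 3) / (pi * Z).
Proof.
move=> /andP[v0 v2] bnd; have p0 := @pi_gt0 R.
pose T (y : R) : R := cos (pi * y) / sin (pi * y).
pose H (y : R) : R := - (T y + T y ^+ 3 / 3) / (pi * Z) - smoothing_cdf y.
pose dH (y : R) : R := (sin (pi * y) ^+ 4)^-1 / Z - smoothing_density y.
(* The cotangent [T] vanishes at [1/2], so monotonicity of [H] up to [1/2] is exactly the tail
   bound. *)
have H2 : H 2^-1 = - 2^-1.
  by rewrite /H /T smoothing_cdf_half cos_pihalf mul0r expr0n /= !mul0r addr0 oppr0 mul0r add0r.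
suff : H v <= H 2^-1 by rewrite H2 /H -/(T v) mulNr; lra.
have s0 y : v <= y <= 2^-1 -> 0 < sin (pi * y).
  by move=> /andP[vy y2]; apply: sin_gt0_pi; apply/andP; split; nra.
apply: (@ler_of_derive_ge0 _ H dH) => // y vy.
  have {}s0 := s0 y vy.
  have lin : is_derive y 1 (fun v => pi * v) pi.
    by apply: (@is_derive_eq _ _ _ (fun v => pi *: v)); rewrite [_ *: _]mulr1.
  have dc : is_derive y 1 (fun v => cos (pi * v)) (- sin (pi * y) * pi).
    exact: (@is_derive1_comp _ cos (fun v => pi * v)).
  have ds : is_derive y 1 (fun v => sin (pi * v)) (cos (pi * y) * pi).
    exact: (@is_derive1_comp _ sin (fun v => pi * v)).
  have dsV : is_derive y 1 (fun v => (sin (pi * v))^-1) (- (sin (pi * y)) ^- 2 *: (cos (pi * y) * pi)).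
    by apply: is_deriveV => //; rewrite gt_eqF.
  have dT : is_derive y 1 T (- pi / sin (pi * y) ^+ 2).
    have dM : is_derive y 1 T _ := is_deriveM dc dsV.
    apply: (is_derive_eq dM).
    rewrite /GRing.scale /=.
    have sN0 : sin (pi * y) != 0 by rewrite gt_eqF.
    transitivity (- pi * (cos (pi * y) ^+ 2 + sin (pi * y) ^+ 2) / sin (pi * y) ^+ 2).
      by field.
    by rewrite cos2Dsin2 mulr1.
  have dT3 : is_derive y 1 (fun v => T v ^+ 3) _ := is_deriveX 3 dT.
  have dS : is_derive y 1 (fun v => T v + 3^-1 *: T v ^+ 3) _ := is_deriveD dT (is_deriveZ 3^-1 dT3).
  have dH' : is_derive y 1 (fun v => (- (pi * Z)^-1) *: (T v + 3^-1 *: T v ^+ 3) - smoothing_cdf v) _ :=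
    is_deriveB (is_deriveZ (- (pi * Z)^-1) dS) (is_derive_smoothing_cdf y).
  have -> : H = (fun v => (- (pi * Z)^-1) *: (T v + 3^-1 *: T v ^+ 3) - smoothing_cdf v).
    apply/funext => w; rewrite /H /GRing.scale /=; ring.
  apply: (is_derive_eq dH'); rewrite /dH; congr (_ - _).
  rewrite /GRing.scale /= /T.
  have sN0 : sin (pi * y) != 0 by rewrite gt_eqF.
  have ZN0 : Z != 0 by rewrite gt_eqF.
  have pN0 : pi != 0 :> R by rewrite gt_eqF.
  transitivity ((cos (pi * y) ^+ 2 + sin (pi * y) ^+ 2) / sin (pi * y) ^+ 4 / Z).
    exact: cot_primitive_identity.
  by rewrite cos2Dsin2 mul1r.
have {}s0 : 0 < sin (pi * y) by apply: s0; case/andP: vy => vy y2; rewrite !ltW.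
rewrite /dH subr_ge0 ler_pdivlMr // -div1r ler_pdivlMr ?exprn_gt0 // mulrC; exact: bnd.
Qed.

End Smoothing.
End Sawtooth.

(** * The triangular weights of the Jackson kernel *)

Definition triangle (l p : nat) : nat := if (p <= l)%N then p.+1 else (l.*2.+1 - p)%N.

(** [F] takes both the weight and the position, so that one splitting into rising and falling halves
    serves the energy and the generating function. *)
Lemma big_triangle (V : nmodType) (l : nat) (F : nat -> nat -> V) :
  \sum_(p < l.*2.+1) F (triangle l p) p =
  \sum_(p < l.+1) F p.+1 p + \sum_(p < l) F (l - p)%N (l.+1 + p)%N.
Proof.
rewrite -(big_mkord xpredT (fun p => F (triangle l p) p)).
rewrite -(big_mkord xpredT (fun p => F p.+1 p)).
rewrite -(big_mkord xpredT (fun p => F (l - p)%N (l.+1 + p)%N)).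
rewrite (big_cat_nat (n := l.+1)) //=; last by lia.
congr (_ + _); first by apply: eq_big_nat => p /andP[_ pl]; rewrite /triangle -ltnS pl.
rewrite -{1}[l.+1]add0n big_addn; have -> : (l.*2.+1 - l.+1 = l)%N by lia.
apply: eq_big_nat => p _; rewrite /triangle ifN; last by rewrite -ltnNge; lia.
by congr (F _ _); lia.
Qed.

Lemma triangle_energy (l : nat) :
  (3 * \sum_(p < l.*2.+1) triangle l p ^ 2 = l.+1 * (2 * l.+1 ^ 2 + 1))%N.
Proof.
have sq m : (6 * \sum_(p < m) p.+1 ^ 2 = m * m.+1 * m.*2.+1)%N.
  by elim: m => [|m IHm]; rewrite ?big_ord0 // big_ord_recr /= mulnDr IHm; lia.
rewrite (big_triangle l (fun t _ => t ^ 2)%N) /= [X in (3 * (_ + X))%N](reindex_inj rev_ord_inj) /=.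
rewrite [X in (3 * (_ + X))%N](eq_bigr (fun p : 'I_l => p.+1 ^ 2)%N); last first.
  by move=> p _; congr (_ ^ 2)%N; have := ltn_ord p => /=; lia.
have := sq l; have := sq l.+1; move: (\sum_(p < l) _)%N (\sum_(p < l.+1) _)%N => a b.
nia.
Qed.

(** The weights are the coefficients of [(1 + z + ... + z^l)^2], so the squared modulus of their sum
    is the fourth power of a Dirichlet kernel. Cleared of its denominator, the identity needs no
    division in [A]. *)
Lemma triangle_generating (A : comPzRingType) (z : A) (l : nat) :
  (1 - z) ^+ 2 * \sum_(p < l.*2.+1) (triangle l p)%:R * z ^+ p = (1 - z ^+ l.+1) ^+ 2.
Proof.
have up m : (1 - z) ^+ 2 * \sum_(p < m) p.+1%:R * z ^+ p = 1 - m.+1%:R * z ^+ m + m%:R * z ^+ m.+1.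
  elim: m => [|m IHm]; first by rewrite big_ord0; ring.
  by rewrite big_ord_recr /= mulrDr IHm -!natr1 !exprS; ring.
have down m : (1 - z) ^+ 2 * \sum_(p < m) (m - p)%:R * z ^+ p = m%:R * (1 - z) - z + z ^+ m.+1.
  elim: m => [|m IHm]; first by rewrite big_ord0; ring.
  have -> : \sum_(p < m.+1) (m.+1 - p)%:R * z ^+ p =
      \sum_(p < m) (m - p)%:R * z ^+ p + \sum_(p < m.+1) z ^+ p.
    rewrite big_ord_recr [in RHS]big_ord_recr /= addrA -big_split /= subSnn mul1r.
    congr (_ + _); apply: eq_bigr => p _.
    by rewrite subSn ?(ltnW (ltn_ord p)) // -natr1 mulrDl mul1r.
  have geo : (1 - z) * \sum_(p < m.+1) z ^+ p = 1 - z ^+ m.+1.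
    by rewrite -opprB mulNr -subrX1 opprB.
  rewrite mulrDr IHm [in X in _ + X = _]expr2 -mulrA geo -natr1 !exprS; ring.
rewrite (big_triangle l (fun t p => t%:R * z ^+ p)) /= mulrDr up.
have -> : \sum_(p < l) (l - p)%:R * z ^+ (l.+1 + p) = z ^+ l.+1 * \sum_(p < l) (l - p)%:R * z ^+ p.
  by rewrite mulr_sumr; apply: eq_bigr => p _; rewrite exprD; ring.
by rewrite [X in _ + X = _]mulrCA down -!natr1 !exprS; ring.
Qed.

(** * The Jackson density bound and the Fejer majorant *)

Section Majorant.
Variable R : realType.
Implicit Types v : R.

Definition triangle_weight l : 'I_l.*2.+1 -> R := fun p => (triangle l p)%:R.

Lemma triangle_weight_energy l :
  \sum_p @triangle_weight l p ^+ 2 = l.+1%:R * (2 * l.+1%:R ^+ 2 + 1) / 3 :> R.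
Proof.
have : 3 * \sum_(p < l.*2.+1) @triangle_weight l p ^+ 2 = l.+1%:R * (2 * l.+1%:R ^+ 2 + 1) :> R.
  have := congr1 (fun t : nat => t%:R : R) (triangle_energy l).
  rewrite !natrM !natrD natrM natrX natr_sum => <-; congr (_ * _).
  by apply: eq_bigr => p _; rewrite natrX.
by move=> <-; rewrite [3 * _]mulrC mulfK ?pnatr_eq0.
Qed.

Lemma triangle_weight_energy_gt0 l : 0 < \sum_p (@triangle_weight l p : R) ^+ 2 :> R.
Proof.
by rewrite triangle_weight_energy divr_gt0 // mulr_gt0 // addr_gt0 // mulr_gt0 // exprn_gt0.
Qed.

(** Taking squared moduli in [triangle_generating] turns the left side into
    [sin^4 (pi (l + 1) v)]. *)
Lemma triangle_density_le l v :
  sin (pi * v) ^+ 4 * (smoothing_density (@triangle_weight l) v * \sum_p @triangle_weight l p ^+ 2) <= 1.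
Proof.
rewrite smoothing_densityE divfK ?gt_eqF ?triangle_weight_energy_gt0 //.
set P := \sum_p _.
have E : (1 - cis v) ^+ 2 * P = (1 - cis (l.+1%:R * v)) ^+ 2.
  rewrite cisMn -triangle_generating; congr (_ * _); apply: eq_bigr => p _.
  by rewrite cisMn /triangle_weight rmorph_nat.
have := congr1 (fun t => normc t ^+ 2) E.
rewrite !normcM [LHS]exprMn !exprMn -!expr2 !normc_1Bcis_sqr.
set s := sin _; set t := sin _; set x := normc _ ^+ 2 => H.
have t1 : t ^+ 2 <= 1 := sin2_le1 _.
have t0 := sqr_ge0 t.
have -> : s ^+ 4 * x = (t ^+ 2) ^+ 2 by nra.
by rewrite expr_le1.
Qed.

(* The Fejer kernel vanishes at the nonzero multiples of [1/N]; its translates by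
   half a step fill these zeros, and [cos^2 + sin^2 = 1] makes the sum at least
   [(N sin (pi v))^-2]. *)
Definition majorant (N : nat) v : R :=
  fejer N v + (fejer N (v - (2 * N%:R)^-1) + fejer N (v + (2 * N%:R)^-1)) / 2.

Lemma majorantN N v : majorant N (- v) = majorant N v.
Proof.
rewrite /majorant fejerN; move: (2 * N%:R)^-1 => h.
have -> : - v - h = - (v + h) by ring.
have -> : - v + h = - (v - h) by ring.
by rewrite !fejerN [fejer N (v + h) + _]addrC.
Qed.

Lemma majorantD1 N v : majorant N (v + 1) = majorant N v.
Proof. by rewrite /majorant [v + 1 - _]addrAC [v + 1 + _]addrAC !fejerD1. Qed.

Lemma majorant_ge0 N v : 0 <= majorant N v.
Proof. by have F := @fejer_ge0 R N; rewrite addr_ge0 ?F // divr_ge0 // addr_ge0. Qed.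

(** Since [N sin (pi v) <= y], the kernel is at least [sin^2 y / y^2]; the quotient is avoided
    because it is undefined at [v = 0]. *)
Lemma fejer_ge_ratio N v (y := pi * (N%:R * v)) (k : R) : (0 < N)%N -> 0 <= v <= 2^-1 -> 0 <= k <= 1 ->
  k * y ^+ 2 <= sin y ^+ 2 -> k <= fejer N v.
Proof.
move=> N0 /andP[]; rewrite le_eqVlt => /predU1P[<- _ /andP[_ k1] _|v0 v2 /andP[k0 _] ky]; first by rewrite fejer0.
have p0 := @pi_gt0 R; have NR : 0 < N%:R :> R by rewrite ltr0n.
have s0 : 0 < sin (pi * v) by apply: sin_gt0_pi; apply/andP; split; nra.
have Ns : 0 < N%:R * sin (pi * v) by rewrite mulr_gt0.
rewrite -(@ler_pM2r _ ((N%:R * sin (pi * v)) ^+ 2)) ?exprn_gt0 // fejer_closed //.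
apply: le_trans ky; rewrite ler_wpM2l // ler_sqr ?nnegrE; [|exact: ltW|by rewrite ltW // !mulr_gt0].
by rewrite /y [X in _ <= X]mulrCA ler_pM2l // sin_lex // mulr_ge0 // ltW.
Qed.

(** The kernel is at least [1/4] within [h] of 0 and at least [1/2] within [h / 2]. For [v <= h / 2]
    the central term suffices; otherwise it gives [1/4], and half of the translate by [h] gives
    another [1/4]. *)
Lemma majorant_ge_half N v : (0 < N)%N -> 0 <= v <= (2 * N%:R)^-1 -> 2^-1 <= majorant N v.
Proof.
move=> N0 /andP[v0 vh]; have p0 := @pi_gt0 R; have := @pihalf_lt2 R => p4.
have NR : 1 <= N%:R :> R by rewrite ler1n.
set h := (2 * N%:R)^-1 in vh *.
have hN : h * (2 * N%:R) = 1 by rewrite mulVf // mulf_neq0 ?gt_eqF // (lt_le_trans _ NR).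
have h2 : h <= 2^-1 by nra.
have half w : 0 <= w <= h -> 4^-1 <= fejer N w.
  move=> /andP[w0 wh]; apply: fejer_ge_ratio => //; try by apply/andP; split; lra.
  set y := pi * _.
  have wN : 0 <= N%:R * w <= 2^-1 by apply/andP; split; nra.
  have y0 : 0 <= y <= pi / 2 by apply/andP; split; rewrite /y; nra.
  have := sin_chord y0; rewrite sin_pihalf mulr1 => /(_ ltac:(lra)) H.
  case/andP: y0 => y0 y1.
  have -> : 4^-1 * y ^+ 2 = (y / 2) ^+ 2 by field.
  rewrite ler_sqr ?nnegrE; [|lra|apply: sin_ge0_pi; apply/andP; split; lra].
  have : 0 <= sin y by apply: sin_ge0_pi; apply/andP; split; lra.
  by nra.
have quarter w : 0 <= w <= h / 2 -> 2^-1 <= fejer N w.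
  move=> /andP[w0 wh]; apply: fejer_ge_ratio => //; try by apply/andP; split; lra.
  set y := pi * _.
  have wN : 0 <= N%:R * w <= 4^-1 by apply/andP; split; nra.
  have y0 : 0 <= y <= pi / 4 by apply/andP; split; rewrite /y; nra.
  have := sin_pi_fourth_chord y0; set S := sin y ^+ 2 => H.
  have S0 : 0 <= S by rewrite sqr_ge0.
  have P1 : (pi / 4) ^+ 2 <= 1 :> R by rewrite expr_le1 //; lra.
  by nra.
rewrite /majorant -/h.
have F0 := fejer_ge0 N (v + h).
have [vh2|vh2] := leP v (h / 2).
  have := quarter v; rewrite v0 vh2 => /(_ isT).
  by have := fejer_ge0 N (v - h); lra.
have := half v; rewrite v0 vh => /(_ isT).
have := quarter (h - v); rewrite -fejerN opprB => /(_ _).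
have -> : 0 <= h - v <= h / 2 by apply/andP; split; lra.
by move=> /(_ isT); lra.
Qed.

Lemma majorant_ge_sin N v : (1 < N)%N -> (2 * N%:R)^-1 <= v <= 2^-1 ->
  1 <= majorant N v * (N%:R * sin (pi * v)) ^+ 2.
Proof.
move=> N1 /andP[hv v2]; have p0 := @pi_gt0 R.
have N0 : (0 < N)%N by apply: ltnW.
have NR : 2 <= N%:R :> R by rewrite (ler_nat _ 2).
have NR0 : N%:R != 0 :> R by rewrite gt_eqF // (lt_le_trans _ NR).
rewrite /majorant; set h := (2 * N%:R)^-1 in hv *.
have hN : h * (2 * N%:R) = 1 by rewrite mulVf // mulf_neq0 ?pnatr_eq0 // -lt0n.
have h0 : 0 < h by rewrite invr_gt0 mulr_gt0 // (lt_le_trans _ NR).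
have h4 : h <= 4^-1 by nra.
have Nh : pi * (N%:R * h) = pi / 2.
  have -> : N%:R * h = 2^-1 by lra.
  by [].
have F1 := fejer_closed v N0; rewrite mulrDl F1.
(* At [v = h] the factor [sin (pi (v - h))] vanishes and cannot be divided by, but there the central
   term alone gives 1. *)
move: hv; rewrite le_eqVlt => /predU1P[hv|hv].
  rewrite -hv Nh sin_pihalf expr1n lerDl mulr_ge0 ?sqr_ge0 //.
  by rewrite divr_ge0 // addr_ge0 // fejer_ge0.
have F2 : fejer N (v - h) * (N%:R * sin (pi * (v - h))) ^+ 2 = cos (pi * (N%:R * v)) ^+ 2.
  by rewrite fejer_closed // !mulrBr Nh sinBpihalf sqrrN.
have F3 : fejer N (v + h) * (N%:R * sin (pi * (v + h))) ^+ 2 = cos (pi * (N%:R * v)) ^+ 2.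
  by rewrite fejer_closed // !mulrDr Nh sinDpihalf.
have a0 : 0 < sin (pi * (v - h)) by apply: sin_gt0_pi; apply/andP; split; nra.
have b0 : 0 < sin (pi * (v + h)) by apply: sin_gt0_pi; apply/andP; split; nra.
have sc := cos2Dsin2 (pi * (N%:R * v)).
have ph : sin (pi * h) < sin (pi * v).
  by rewrite ltr_sin ?in_itv /=; [nra|apply/andP; split; nra..].
have h0' : 0 < sin (pi * h) by apply: sin_gt0_pi; apply/andP; split; nra.
have abE : sin (pi * (v - h)) * sin (pi * (v + h)) = sin (pi * v) ^+ 2 - sin (pi * h) ^+ 2.
  rewrite mulrBr mulrDr sinB sinD.
  transitivity (sin (pi * v) ^+ 2 * cos (pi * h) ^+ 2 - cos (pi * v) ^+ 2 * sin (pi * h) ^+ 2); first ring.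
  by rewrite !cos2sin2; ring.
have abS : sin (pi * (v - h)) ^+ 2 + sin (pi * (v + h)) ^+ 2 =
   2 * (sin (pi * v) ^+ 2 + sin (pi * h) ^+ 2 - 2 * sin (pi * v) ^+ 2 * sin (pi * h) ^+ 2).
  rewrite mulrBr mulrDr sinB sinD.
  transitivity (2 * (sin (pi * v) ^+ 2 * cos (pi * h) ^+ 2 + cos (pi * v) ^+ 2 * sin (pi * h) ^+ 2)); first ring.
  by rewrite !cos2sin2; ring.
have p1 : sin (pi * v) ^+ 2 <= 1 := sin2_le1 _.
move: F2 F3 a0 b0 abE abS p1 sc ph h0'.
set a := sin (pi * (v - h)); set b := sin (pi * (v + h)); set s := sin (pi * v).
set r := sin (pi * h); set C := cos _ ^+ 2; set S := sin _ ^+ 2.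
set f := fejer N (v - h); set g := fejer N (v + h); set n := N%:R.
move=> F2 F3 a0 b0 abE abS p1 sc ph h0'.
have C0 : 0 <= C by rewrite sqr_ge0.
have a2 : 0 < a ^+ 2 by rewrite exprn_gt0.
have b2 : 0 < b ^+ 2 by rewrite exprn_gt0.
have fE : f * n ^+ 2 = C / a ^+ 2 by apply/(canRL (mulfK _)); rewrite ?gt_eqF // -F2; ring.
have gE : g * n ^+ 2 = C / b ^+ 2 by apply/(canRL (mulfK _)); rewrite ?gt_eqF // -F3; ring.
have -> : (f + g) / 2 * (n * s) ^+ 2 = s ^+ 2 / 2 * (f * n ^+ 2 + g * n ^+ 2) by field.
rewrite fE gE.
have -> : s ^+ 2 / 2 * (C / a ^+ 2 + C / b ^+ 2) = C * (s ^+ 2 * (a ^+ 2 + b ^+ 2) / (2 * (a * b) ^+ 2)).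
  by field; rewrite !gt_eqF.
(* It suffices that the mean of [1 / a^2] and [1 / b^2] is at least [1 / s^2]: the translates then
   contribute at least [C], and [S + C = 1]. *)
suff : 1 <= s ^+ 2 * (a ^+ 2 + b ^+ 2) / (2 * (a * b) ^+ 2) by nra.
rewrite ler_pdivlMr ?mulr_gt0 ?exprn_gt0 ?mulr_gt0 // mul1r abE abS.
have rs : r ^+ 2 <= s ^+ 2 by rewrite ltW // ltr_sqr // nnegrE ltW // (lt_trans h0').
have r0 := sqr_ge0 r.
move: (r ^+ 2) (s ^+ 2) rs r0 p1 => q p qp q0 p1.
rewrite -subr_ge0.
have -> : p * (2 * (p + q - 2 * p * q)) - 2 * (p - q) ^+ 2 = 2 * q * (p - q + 2 * p * (1 - p)) by ring.
by rewrite mulr_ge0 ?mulr_ge0 // addr_ge0 ?mulr_ge0 ?subr_ge0 //; lra.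
Qed.

End Majorant.

(** * Approximation of the indicator of an interval *)

Section SawtoothError.
Variable R : realType.
Implicit Types v x a b : R.

Lemma periodic_int (f : R -> R) v (m : int) :
  (forall y, f (y + 1) = f y) -> f (v + m%:~R) = f v.
Proof.
move=> per.
have nat_case (n : nat) y : f (y + n%:R) = f y.
  by elim: n => [|n IHn]; rewrite ?addr0 // -natr1 addrA per.
case: m => n; first by rewrite -pmulrn nat_case.
by rewrite NegzE mulrNz -pmulrn -[in RHS](subrK n.+1%:R v) nat_case.
Qed.

Lemma fracR_ge0_lt1 x : 0 <= fracR x < 1.
Proof.
rewrite /fracR subr_ge0 ltrBlDl; have /andP[-> ] := floor_itv x.
by rewrite intrD.
Qed.

(** The difference of the identities at [a] and at [b] writes the indicator of [[a, b)] as a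
    difference of floors, which reduces the smoothing error to one sawtooth per endpoint. *)
Lemma floorB x a : 0 <= a <= 1 ->
  (Num.floor (x - a))%:~R = (Num.floor x)%:~R - (fracR x < a)%R%:R :> R.
Proof.
move=> /andP[a0 a1]; have /andP[f0 f1] := fracR_ge0_lt1 x.
have xE : x = (Num.floor x)%:~R + fracR x by rewrite /fracR addrC subrK.
have [fa|fa] := ltP (fracR x) a.
  rewrite (@floor_def _ _ (Num.floor x - 1)) ?intrB //.
  by rewrite intrD intrB; apply/andP; split; lra.
rewrite (@floor_def _ _ (Num.floor x)) ?subr0 //.
by rewrite intrD; apply/andP; split; lra.
Qed.

Variable K : nat.
Hypothesis K7 : (7 <= K)%N.
Local Notation N := K.+1.
Local Notation c := (@triangle_weight R K./2).
Local Notation E_gt0 := (triangle_weight_energy_gt0 R K./2).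
Local Notation Psi := (smoothing_cdf c).

Lemma triangle_weight_energy_ge : N%:R ^+ 3 / 12 <= \sum_p c p ^+ 2.
Proof.
rewrite triangle_weight_energy.
have : N%:R <= 2 * (K./2).+1%:R :> R by rewrite -natrM ler_nat; lia.
have : 1 <= (K./2).+1%:R :> R by rewrite ler1n.
have : 0 <= N%:R :> R by [].
move: (N%:R) ((K./2).+1%:R) => n L n0 L1 nL.
have n3 : n ^+ 3 <= (2 * L) ^+ 3 by rewrite lerXn2r ?nnegrE //; lra.
suff : (2 * L) ^+ 3 / 12 <= L * (2 * L ^+ 2 + 1) / 3 by lra.
have -> : (2 * L) ^+ 3 / 12 = L * (2 * L ^+ 2) / 3 by field.
by nra.
Qed.

(** With [y = N sin (pi v)], the majorant is at least [1/2] when [v <= 1 / (2N)] or [y^2 <= 2],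
    which suffices as [Psi v >= 0]. Otherwise the cotangent bound on the tail is compared with
    [1 / y^2]. *)
Lemma sawtooth_half v : 0 <= v <= 2^-1 -> 2^-1 - Psi v <= majorant N v.
Proof.
move=> /andP[v0 v2]; have p3 := @pi_ge3 R.
have Psi0 : 0 <= Psi v.
  have P0 : Psi 0 = 0 by have := smoothing_cdfN c 0; rewrite oppr0; lra.
  by rewrite -P0; apply: smoothing_cdf_le v0; exact: E_gt0.
have [vh|hv] := leP v (2 * N%:R)^-1.
  have : 2^-1 <= majorant N v by apply: majorant_ge_half => //; rewrite v0.
  lra.
have N8 : 8 <= N%:R :> R by rewrite (ler_nat _ 8).
have h0 : 0 < (2 * N%:R)^-1 :> R by rewrite invr_gt0 mulr_gt0.
have {}v0 : 0 < v by apply: lt_trans hv.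
have M1 : 1 <= majorant N v * (N%:R * sin (pi * v)) ^+ 2.
  by apply: majorant_ge_sin; rewrite ?ltnS ?(leq_trans _ K7) // ltW.
have s0 : 0 < sin (pi * v) by apply: sin_gt0_pi; apply/andP; split; nra.
have M0 := majorant_ge0 N v.
have [y2|y2] := leP ((N%:R * sin (pi * v)) ^+ 2) 2.
  suff : 2^-1 <= majorant N v by lra.
  have : majorant N v * (N%:R * sin (pi * v)) ^+ 2 <= majorant N v * 2 by rewrite ler_wpM2l.
  by lra.
apply: le_trans (smoothing_cdf_tail _ _ (@triangle_density_le _ _)) _.
- exact: E_gt0.
- by rewrite v0.
have Z := triangle_weight_energy_ge; have Z0 := E_gt0.
have c0 : 0 <= cos (pi * v) by apply: cos_ge0_pihalf; apply/andP; split; nra.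
have cs := cos2Dsin2 (pi * v).
have s1 := sin_le1 (pi * v).
move: y2 M1 Z Z0; set y := N%:R * sin (pi * v); set W := \sum_p _ => y2 M1 Z Z0.
have y0 : 0 < y by rewrite mulr_gt0.
have y2V : (y ^+ 2)^-1 <= majorant N v by rewrite -div1r ler_pdivrMr ?exprn_gt0.
apply: le_trans y2V.
(* From [pi >= 3] and [W >= N^3 / 12]. *)
have pZ : N%:R ^+ 3 / 4 <= pi * W by nra.
have N3 : 0 < N%:R ^+ 3 :> R by rewrite exprn_gt0.
have yE : y = N%:R * sin (pi * v) by [].
move: (cos (pi * v)) (sin (pi * v)) (N%:R) c0 cs s1 s0 N8 yE pZ N3.
move=> C s n c0 cs s1 s0 n8 yE pZ n3.
have sN : s != 0 by rewrite gt_eqF.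
have n0 : 0 < n by lra.
have -> : C / s + (C / s) ^+ 3 / 3 = C * (C ^+ 2 + 3 * s ^+ 2) / (3 * s ^+ 3) by field.
have -> : C ^+ 2 + 3 * s ^+ 2 = 1 + 2 * s ^+ 2 by lra.
apply: (@le_trans _ _ (C * (1 + 2 * s ^+ 2) / (3 * s ^+ 3) / (n ^+ 3 / 4))).
  rewrite ler_wpM2l ?divr_ge0 ?mulr_ge0 ?addr_ge0 ?mulr_ge0 ?exprn_ge0 ?(ltW s0) //.
  by rewrite lef_pV2 ?posrE ?divr_gt0 ?mulr_gt0 //; lra.
have -> : C * (1 + 2 * s ^+ 2) / (3 * s ^+ 3) / (n ^+ 3 / 4) = 4 / 3 * C * (1 + 2 * s ^+ 2) / y / y ^+ 2.
  by rewrite yE; field; rewrite sN gt_eqF.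
rewrite -[X in _ <= X]mul1r ler_wpM2r ?invr_ge0 ?exprn_ge0 ?(ltW y0) //.
rewrite ler_pdivrMr // mul1r.
have Cle : C <= 1 - s ^+ 2 / 2.
  have t0 : 0 <= 1 - s ^+ 2 / 2 by nra.
  rewrite -(ler_sqr) ?nnegrE //.
  have -> : C ^+ 2 = 1 - s ^+ 2 by lra.
  by have := sqr_ge0 (s ^+ 2 / 2); lra.
have Cs : C * (1 + 2 * s ^+ 2) <= 1 + 3 / 2 * s ^+ 2.
  apply: (@le_trans _ _ ((1 - s ^+ 2 / 2) * (1 + 2 * s ^+ 2))).
    by rewrite ler_wpM2r // addr_ge0 // mulr_ge0 // exprn_ge0 // ltW.
  by have := sqr_ge0 (s ^+ 2); lra.
have : 4 / 3 + 2 * s ^+ 2 <= y; last by lra.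
(* This is where [K >= 7] enters. It remains to see [4/3 + y^2 / 32 <= y] for [y] between about
   [sqrt 2] and 8; beyond 8, [s <= 1] suffices. *)
have s8 : 8 * s <= y by rewrite yE ler_wpM2r // ltW.
have y14 : 1414 / 1000 <= y.
  by rewrite -ler_sqr ?nnegrE ?(ltW y0) //; lra.
have [y8|y8] := leP y 8.
  have : (8 * s) * (8 * s) <= y * y by apply: ler_pM; lra.
  by nra.
by nra.
Qed.

(** Periodicity reduces to [[0, 1)], and the symmetry of [Psi] about [1/2] to [[0, 1/2]]. *)
Lemma sawtooth_error v : `|Psi v - (Num.floor v)%:~R - 2^-1| <= majorant N v.
Proof.
have vE : fracR v + (Num.floor v)%:~R = v by rewrite /fracR subrK.
have PsiB y : Psi (y + 1) - (y + 1) = Psi y - y.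
  by rewrite smoothing_cdfD1 ?E_gt0 //; ring.
have := @periodic_int (fun y => Psi y - y) (fracR v) (Num.floor v) PsiB.
have := periodic_int (fracR v) (Num.floor v) (@majorantD1 R N).
rewrite vE => -> PE.
have -> : Psi v - (Num.floor v)%:~R - 2^-1 = Psi (fracR v) - 2^-1.
  by move: PE; rewrite /fracR; lra.
have /andP[] := fracR_ge0_lt1 v; move: (fracR v) => y y0 y1 {PsiB PE vE}.
have half w : 0 <= w <= 2^-1 -> `|Psi w - 2^-1| <= majorant N w.
  move=> /[dup] w2 /andP[_ wl]; rewrite distrC ger0_norm ?sawtooth_half //.
  by rewrite subr_ge0 -[X in _ <= X](smoothing_cdf_half E_gt0) smoothing_cdf_le ?E_gt0.
have [y2|y2] := leP y 2^-1; first by rewrite half // y0.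
have -> : Psi y - 2^-1 = - (Psi (1 - y) - 2^-1).
  by rewrite addrC [1 - _]addrC smoothing_cdfD1 ?E_gt0 // smoothing_cdfN; lra.
rewrite normrN -majorantN -majorantD1 [- y + 1]addrC half //.
by apply/andP; split; lra.
Qed.

Definition smooth_indicator a b x := Psi (x - a) - Psi (x - b).

Lemma smooth_indicator_itv a b x : a <= b <= a + 1 -> 0 <= smooth_indicator a b x <= 1.
Proof.
move=> /andP[ab b1]; rewrite /smooth_indicator subr_ge0 lerBlDl.
rewrite smoothing_cdf_le ?E_gt0 ?lerB //=.
rewrite addrC -smoothing_cdfD1 ?E_gt0 // smoothing_cdf_le ?E_gt0 //; lra.
Qed.

Lemma smooth_indicator_error a b x : 0 <= a -> a <= b -> b <= 1 ->
  `|((a <= fracR x) && (fracR x < b))%R%:R - smooth_indicator a b x| <=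
  majorant N (x - a) + majorant N (x - b).
Proof.
move=> a0 ab b1.
have := sawtooth_error (x - a); have := sawtooth_error (x - b).
have a01 : 0 <= a <= 1 by rewrite a0 (le_trans ab).
have b01 : 0 <= b <= 1 by rewrite b1 (le_trans a0).
rewrite (floorB x a01) (floorB x b01).
have -> : ((a <= fracR x) && (fracR x < b))%R%:R = (fracR x < b)%R%:R - (fracR x < a)%R%:R :> R.
  rewrite leNgt; case: (ltP (fracR x) b) => xb; case: (ltP (fracR x) a) => xa /=.
  - by rewrite subrr.
  - by rewrite subr0.
  - by have := lt_le_trans xa (le_trans ab xb); rewrite ltxx.
  - by rewrite subr0.
rewrite /smooth_indicator => Eb Ea.
apply: le_trans (lerD Ea Eb); rewrite -[X in _ <= X + _]normrN.
apply: le_trans (ler_normD _ _); rewrite le_eqVlt; apply/orP; left.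
by apply/eqP; congr (`|_|); ring.
Qed.

End SawtoothError.

(** * The distance to the nearest integer *)

Section DistanceToIntegers.
Variable R : realType.
Implicit Types x y : R.

Lemma distZE x : distZ x = if fracR x <= 2^-1 then fracR x else 1 - fracR x.
Proof.
rewrite /distZ (_ : _ + 1 - x = 1 - fracR x); last by rewrite /fracR; ring.
by rewrite -/(fracR x); case: (leP (fracR x)) => H; [rewrite min_l //|rewrite min_r //]; lra.
Qed.

Lemma distZ_bounds x : 0 <= distZ x <= 2^-1.
Proof. by have /andP[f0 f1] := fracR_ge0_lt1 x; rewrite distZE; case: (leP (fracR x)) => H; apply/andP; split; lra. Qed.

Lemma distZ_le x (m : int) : distZ x <= `|x - m%:~R|.
Proof.
have /andP[f0 f1] := fracR_ge0_lt1 x.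
have xE : x = (Num.floor x)%:~R + fracR x by rewrite /fracR addrC subrK.
have [mf|fm] := leP m (Num.floor x).
  have : m%:~R <= (Num.floor x)%:~R :> R by rewrite ler_int.
  have := ler_norm (x - m%:~R).
  by rewrite distZE; case: (leP (fracR x)); lra.
have : (Num.floor x)%:~R + 1 <= m%:~R :> R by rewrite -(intrD _ _ 1) ler_int lezD1.
have := ler_norm (m%:~R - x); rewrite distrC.
by rewrite distZE; case: (leP (fracR x)); lra.
Qed.

(** On each half of the period [distZ] is an isometry of the fractional part; the half chosen in
    each coordinate is the orthant of the packing argument. *)
Lemma distZ_sub x y : (fracR x <= 2^-1) = (fracR y <= 2^-1) ->
  distZ (x - y) <= `|distZ x - distZ y|.
Proof.
move=> xy; apply: le_trans (distZ_le _ (Num.floor x - Num.floor y)) _.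
rewrite intrB (_ : x - y - _ = fracR x - fracR y); last by rewrite /fracR; ring.
rewrite !distZE xy; case: ifP => _ //.
by rewrite distrC (_ : fracR y - fracR x = 1 - fracR x - (1 - fracR y)) //; ring.
Qed.

Lemma norm_cos_le_distZ x : `|cos (2 * pi * x)| <= 1 - 4 * distZ (2 * x) ^+ 2.
Proof.
have -> : 2 * pi * x = pi * (2 * x) by ring.
have abs_per z : `|cos (pi * (z + 1))| = `|cos (pi * z)| :> R.
  by rewrite mulrDr mulr1 cosDpi normrN.
have := @periodic_int _ (fun z => `|cos (pi * z)|) (fracR (2 * x)) (Num.floor (2 * x)) abs_per.
have -> : fracR (2 * x) + (Num.floor (2 * x))%:~R = 2 * x by rewrite /fracR subrK.
move=> ->; rewrite distZE; have p0 := @pi_gt0 R.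
have /andP[] := fracR_ge0_lt1 (2 * x); move: (fracR _) => t t0 t1.
have half (w : R) : 0 <= w <= 2^-1 -> `|cos (pi * w)| <= 1 - 4 * w ^+ 2.
  move=> /andP[w0 w2]; rewrite ger0_norm ?cos_pi_quad ?ger0_norm //.
  apply: cos_ge0_pihalf; apply/andP; split; last by rewrite ler_wpM2l // pi_ge0.
  by have := mulr_ge0 (ltW p0) w0; lra.
case: (leP t) => t2; first by rewrite half // t0.
have -> : pi * t = pi - pi * (1 - t) by ring.
rewrite addrC cosDpi cosN normrN half //; apply/andP; split; lra.
Qed.

End DistanceToIntegers.

(** * The packing sum and its numerical bound *)

Section Packing.
Variable R : realType.

Lemma geometric_le (q : R) m : 0 <= q < 1 -> \sum_(j < m) q ^+ j <= (1 - q)^-1.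
Proof.
move=> /andP[q0 q1]; rewrite -[_^-1]mul1r ler_pdivlMr ?subr_gt0 // mulrC.
by rewrite -opprB mulNr -subrX1 opprB gerBl exprn_ge0.
Qed.

(* Each unit cell, together with a sign vector, contains at most one of the points. *)
Lemma packing_sum (n : nat) (H : finType) (h0 : H) (u : H -> 'I_n -> R)
    (sgn : H -> 'I_n -> bool) (q : R) : 0 <= q < 1 ->
  (forall h i, 0 <= u h i) ->
  (forall h h', h != h' -> exists i, sgn h i != sgn h' i \/ 1 <= `|u h i - u h' i|) ->
  (forall h, h != h0 -> exists i, 1 <= u h i) ->
  \sum_(h | h != h0) \prod_i q ^+ Num.truncn (u h i) <= 2 ^+ n * ((1 - q) ^- n - 1).
Proof.
move=> q01 u0 sep far; have /andP[q0 q1] := q01.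
(* A common bound on the cell indices makes the set of cells a finite type. *)
pose B := (\max_h \max_i Num.truncn (u h i))%N.
have uB h i : (Num.truncn (u h i) < B.+1)%N.
  rewrite ltnS; apply: leq_trans (leq_bigmax h).
  exact: (leq_bigmax (F := fun i => Num.truncn (u h i)) i).
pose cell h : {ffun 'I_n -> bool * 'I_B.+1} := [ffun i => (sgn h i, Ordinal (uB h i))].
pose F (p : {ffun 'I_n -> bool * 'I_B.+1}) : R := \prod_i q ^+ (p i).2.
have F0 p : 0 <= F p by apply: prodr_ge0 => i _; rewrite exprn_ge0.
have cell_inj : injective cell.
  move=> h h' /ffunP E; apply/eqP/negP => /negP/sep[i []].
    by have := E i; rewrite !ffunE => -[-> _]; rewrite eqxx.
  have := E i; rewrite !ffunE => -[_ T].
  have /andP[a1 a2] := truncn_itv (u0 h i); have /andP[b1 b2] := truncn_itv (u0 h' i).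
  rewrite T in a1 a2; rewrite leNgt => /negP; apply.
  by rewrite ltr_norml -natr1 in a2 b2 *; apply/andP; split; lra.
have -> : \sum_(h | h != h0) \prod_i q ^+ Num.truncn (u h i) = \sum_(h | h != h0) F (cell h).
  by apply: eq_bigr => h _; apply: eq_bigr => i _; rewrite ffunE.
(* The [2 ^ n] cells at the origin, one per sign vector: by the last hypothesis they contain no
   point other than [h0], which accounts for the [- 1] in the bound. *)
pose Z := [set p : {ffun 'I_n -> bool * 'I_B.+1} | [forall i, (p i).2 == 0%N :> nat]].
have -> : \sum_(h | h != h0) F (cell h) = \sum_(p in cell @: [set h | h != h0]) F p.
  by rewrite big_imset /=; [apply: eq_bigl => h; rewrite inE | move=> ? ? _ _; apply: cell_inj].
apply: (@le_trans _ _ (\sum_(p in ~: Z) F p)).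
  rewrite [X in _ <= X](big_setID (cell @: [set h | h != h0])) /=.
  have -> : ~: Z :&: cell @: [set h | h != h0] = cell @: [set h | h != h0].
    apply/finset.setIidPr/fintype.subsetP => p /imsetP[h]; rewrite inE => /far[i ui] ->.
    rewrite !inE; apply/forallPn; exists i; rewrite ffunE /= -lt0n.
    by rewrite truncn_gt0.
  by rewrite lerDl sumr_ge0.
have total : \sum_p F p = (2 * \sum_(j < B.+1) q ^+ j) ^+ n.
  rewrite -[in RHS](card_ord n) -prodr_const.
  have -> : 2 * \sum_(j < B.+1) q ^+ j = \sum_(p : bool * 'I_B.+1) q ^+ p.2.
    rewrite -(pair_big xpredT xpredT (fun (b : bool) (j : 'I_B.+1) => q ^+ j)) /=.
    by rewrite big_bool /= mulr2n mulrDl mul1r.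
  by rewrite bigA_distr_bigA.
have zeros : \sum_(p in Z) F p = 2 ^+ n.
  have -> : 2 ^+ n = \prod_(i < n) \sum_(x : bool * 'I_B.+1) (x.2 == 0 :> nat)%:R :> R.
    rewrite prodr_const card_ord; congr (_ ^+ _).
    rewrite -(pair_big xpredT xpredT (fun (b : bool) (j : 'I_B.+1) => (j == 0 :> nat)%:R)) /=.
    by rewrite big_bool /= big_ord_recl /= big1 // addr0.
  rewrite bigA_distr_bigA big_mkcond /=; apply: eq_bigr => p _; rewrite inE.
  case: ifPn => [/forallP pz|/forallPn[i pi]].
    by apply: eq_bigr => i _; rewrite (eqP (pz i)) eqxx expr0.
  by rewrite (bigD1 i) //= (negbTE pi) mul0r.
have : \sum_p F p = \sum_(p in Z) F p + \sum_(p in ~: Z) F p.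
  rewrite (bigID (mem Z)) /=; by congr (_ + _); apply: eq_bigl => p; rewrite ?finset.in_setC.
rewrite total zeros => E.
have -> : \sum_(p in ~: Z) F p = (2 * \sum_(j < B.+1) q ^+ j) ^+ n - 2 ^+ n by lra.
rewrite mulrBr mulr1 lerB // exprMn ler_wpM2l ?exprn_ge0 // -exprVn.
by rewrite lerXn2r ?nnegrE ?sumr_ge0 ?geometric_le ?invr_ge0 ?subr_ge0 ?(ltW q1) // => j _; rewrite exprn_ge0.
Qed.

Lemma bernoulli_sub (q : R) n : 0 <= q <= 1 -> 1 - n%:R * q <= (1 - q) ^+ n.
Proof.
move=> /andP[q0 q1]; elim: n => [|n IHn]; first by rewrite mul0r subr0.
have : (1 - n%:R * q) * (1 - q) <= (1 - q) ^+ n.+1.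
  by rewrite exprSr ler_wpM2r // subr_ge0.
have : 0 <= n%:R * q * q by rewrite !mulr_ge0.
by rewrite -natr1; lra.
Qed.

(** Increasing [n] by one multiplies the left side by at most [2 x <= 1]. *)
Lemma natr_expr_le (x : R) n : 0 <= x <= 2^-1 -> (0 < n)%N -> n%:R * x ^+ n <= x.
Proof.
move=> /andP[x0 x2]; elim: n => // -[|n] IHn _; first by rewrite mul1r expr1.
have {IHn} := IHn isT; set N := n.+1 => IHn.
have : 1 <= N%:R :> R by rewrite ler1n.
have : 0 <= x ^+ N by rewrite exprn_ge0.
rewrite -natr1 exprSr; move: (x ^+ N) IHn => y IHn y0 N1.
have : (N%:R + 1) * y <= 2 * x by nra.
rewrite mulrA => H; apply: (@le_trans _ _ (2 * x * x)); first by rewrite ler_wpM2r.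
by nra.
Qed.

Lemma expR_half_ge : 1636 / 1000 <= expR 2^-1 :> R.
Proof.
have -> : 2^-1 = 16%:R * 32^-1 :> R by field.
rewrite expRM_natl.
have H : 33 / 32 <= expR 32^-1 :> R.
  by apply: le_trans (expR_ge1Dx _); lra.
have : (33 / 32) ^+ 16 <= expR 32^-1 ^+ 16 :> R by rewrite lerXn2r ?nnegrE ?expR_ge0 //; lra.
by apply: le_trans; lra.
Qed.

(** By Bernoulli the left side is at most [n rho^n / (1 - n r^n)] with [rho = 2 exp (-2)] and
    [r = exp (-3/2)]; both products are largest at [n = 1], where [rho <= 2/7] and
    [r <= 1000/4375]. *)
Lemma packing_bound_le n : (0 < n)%N ->
  expR (- (n%:R / 2)) * (2 ^+ n * ((1 - expR (- (3 / 2 * n%:R))) ^- n - 1)) <= 19 / 50 :> R.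
Proof.
move=> n0; have e0 := @expR_gt0 R 2^-1; have e1 := expR_half_ge.
set e := expR 2^-1 in e0 e1.
have -> : expR (- (n%:R / 2)) = (e^-1) ^+ n by rewrite expRN exprVn /e -expRM_natl.
have -> : expR (- (3 / 2 * n%:R)) = (e ^- 3) ^+ n.
  rewrite expRN [RHS]exprVn -exprM /e -expRM_natl natrM.
  by congr ((expR _)^-1); field.
have e3 : 4375 / 1000 <= e ^+ 3.
  have : (1636 / 1000) ^+ 3 <= e ^+ 3 by rewrite lerXn2r ?nnegrE ?(ltW e0) //; lra.
  by apply: le_trans; lra.
have e4 : 7 <= e ^+ 4.
  have : (1636 / 1000) ^+ 4 <= e ^+ 4 by rewrite lerXn2r ?nnegrE ?(ltW e0) //; lra.
  by apply: le_trans; lra.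
set r := e ^- 3.
have r0 : 0 < r by rewrite invr_gt0 exprn_gt0.
have r1 : r <= 1000 / 4375 by rewrite /r -[X in _ <= X]invrK lef_pV2 ?posrE ?exprn_gt0 //; lra.
pose rho := 2 * e ^- 4.
have rho0 : 0 < rho by rewrite mulr_gt0 // invr_gt0 exprn_gt0.
have rho1 : rho <= 2 / 7 by rewrite /rho ler_pM2l // lef_pV2 ?posrE ?exprn_gt0.
have nr : n%:R * r ^+ n <= r by apply: natr_expr_le => //; apply/andP; split; lra.
have nrho : n%:R * rho ^+ n <= rho by apply: natr_expr_le => //; apply/andP; split; lra.
have rn0 : 0 <= r ^+ n by rewrite exprn_ge0 // ltW.
have rn1 : r ^+ n <= 1 by rewrite exprn_ile1 //; lra.
have B := @bernoulli_sub (r ^+ n) n; rewrite rn0 rn1 in B; have {}B := B isT.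
have D0 : 0 < 1 - n%:R * r ^+ n by lra.
have : (1 - r ^+ n) ^- n <= (1 - n%:R * r ^+ n)^-1 by rewrite lef_pV2 ?posrE // (lt_le_trans D0).
move=> H.
apply: (@le_trans _ _ (e^-1 ^+ n * (2 ^+ n * ((1 - n%:R * r ^+ n)^-1 - 1)))).
  by rewrite ler_wpM2l ?exprn_ge0 ?invr_ge0 ?(ltW e0) // ler_wpM2l ?exprn_ge0 // lerB.
have -> : e^-1 ^+ n * (2 ^+ n * ((1 - n%:R * r ^+ n)^-1 - 1)) = n%:R * rho ^+ n / (1 - n%:R * r ^+ n).
  have -> : rho = e^-1 * 2 * r.
    by rewrite /rho /r; field; rewrite gt_eqF.
  by rewrite !exprMn; field; rewrite gt_eqF.
rewrite ler_pdivrMr //; lra.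
Qed.

End Packing.

(** * The cube of frequencies *)

Section Frequencies.
Variables d K : nat.
Local Notation index := {ffun 'I_d -> 'I_K.*2.+1}.

(** The shift by [K] makes the finite type [index] enumerate the integer vectors of sup norm at most
    [K]. *)
Definition freq (h : index) : 'I_d -> int := fun l => (h l)%:Z - K%:Z.

Definition freq0 : index := [ffun=> inord K].

Lemma freq_neq (h h' : index) : h != h' -> exists l, freq h l - freq h' l != 0.
Proof.
move=> hh; apply: contrapT => E; move/eqP: hh; apply; apply/ffunP => l; apply/val_inj.
have [|H] := eqVneq (freq h l - freq h' l) 0; first by rewrite /freq /=; lia.
by case: E; exists l.
Qed.

Lemma freq_freq0 l : freq freq0 l = 0.
Proof. by rewrite /freq ffunE inordK ?subrr // ltnS -addnn leq_addl. Qed.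

Lemma freq_norm (R : realType) (h : index) l : `|(freq h l)%:~R| <= K%:R :> R.
Proof.
rewrite -intr_norm -[K%:R]/(K%:Z%:~R) ler_int /freq.
by have := ltn_ord (h l); rewrite ltnS; lia.
Qed.

End Frequencies.

(** * Decay of the Fourier coefficients of the walk *)

Section WalkCharacters.
Variable R : realType.
Variables (n d : nat) (A : 'M[R]_(n, d)).
Hypothesis n_gt0 : (0 < n)%N.
Implicit Types h : 'I_d -> int.

(** The Fourier coefficient of [Q] at [h], real because [Q] is symmetric. *)
Definition walk_char h : R := (\sum_i cos (2 * pi * matvecZ A h i)) / n%:R.

Lemma walk_char_le h :
  `|walk_char h| <= expR (- (4 / n%:R * \sum_i distZ (2 * matvecZ A h i) ^+ 2)).
Proof.
have nR : 0 < n%:R :> R by rewrite ltr0n.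
apply: (@le_trans _ _ (1 - 4 / n%:R * \sum_i distZ (2 * matvecZ A h i) ^+ 2)); last first.
  exact: expR_ge1Dx.
rewrite /walk_char normrM normfV (gtr0_norm nR) ler_pdivrMr //.
apply: le_trans (ler_norm_sum _ _ _) _.
apply: (@le_trans _ _ (\sum_(i < n) (1 - 4 * distZ (2 * matvecZ A h i) ^+ 2))).
  by apply: ler_sum => i _; apply: norm_cos_le_distZ.
rewrite sumrB sumr_const card_ord -mulr_sumr mulrBl mul1r lerB //.
by rewrite mulrAC divfK // gt_eqF.
Qed.

Lemma matvecZB h h' i : matvecZ A (fun l => h l - h' l) i = matvecZ A h i - matvecZ A h' i.
Proof. by rewrite /matvecZ -sumrB; apply: eq_bigr => l _; rewrite intrB mulrBr. Qed.

Lemma matvecZ2 h i : matvecZ A (fun l => 2 * h l) i = 2 * matvecZ A h i.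
Proof. by rewrite /matvecZ mulr_sumr; apply: eq_bigr => l _; rewrite intrM; ring. Qed.

Lemma supnormZ_ge m (h : 'I_m -> int) l : `|(h l)%:~R| <= supnormZ R h.
Proof. exact: (le_bigmax_cond _ (fun i : 'I_m => `|(h i)%:~R : R|)). Qed.

Lemma supnormZ_le m (h : 'I_m -> int) (B : R) :
  0 <= B -> (forall l, `|(h l)%:~R : R| <= B) -> supnormZ R h <= B.
Proof. by move=> B0 hB; apply: bigmax_le => // l _; apply: hB. Qed.

Lemma supnormZ_ge1 m (h : 'I_m -> int) l : h l != 0 -> 1 <= supnormZ R h.
Proof.
move=> hl; apply: le_trans (supnormZ_ge h l).
by rewrite -intr_norm (ler_int _ 1) -gtz0_ge1 normr_gt0.
Qed.

Variable C : R.
Hypothesis AC : approx_const A C.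

(** The usable form of bad approximability: an upper bound replaces the norm, and a single
    coordinate replaces the maximum. *)
Lemma approx_const_exists h (B : R) : (exists l, h l != 0) -> supnormZ R h <= B ->
  exists i, C / B `^ (d%:R / n%:R) < distZ (matvecZ A h i).
Proof.
have [C0 ac] := AC; move=> h0 hB; have := ac h h0.
have [l hl] := h0; have h1 := supnormZ_ge1 hl.
have B0 : 0 < B by apply: lt_le_trans hB; apply: lt_le_trans h1.
move=> dz.
have le1 : C / B `^ (d%:R / n%:R) <= C / supnormZ R h `^ (d%:R / n%:R).
  have N0 : 0 < supnormZ R h by apply: lt_le_trans h1.
  rewrite ler_pM2l // lef_pV2 ?posrE ?powR_gt0 //.
  by apply: ge0_ler_powR; rewrite ?nnegrE ?divr_ge0 // ltW.
apply: contrapT => far; have := le_lt_trans le1 dz; rewrite ltNge => /negP; apply.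
apply: bigmax_le => [|i _].
  by rewrite divr_ge0 ?powR_ge0 // ltW.
by rewrite leNgt; apply/negP => lt; apply: far; exists i.
Qed.

Variables (k K : nat) (X : R).
Hypothesis X_gt0 : 0 < X.
Hypothesis k_gt0 : (0 < k)%N.
Hypothesis d_gt0 : (0 < d)%N.
Hypothesis XE : (C * X `^ (d%:R / n%:R)) ^+ 2 = n%:R ^+ 2 / (2 * k%:R).
Hypothesis KX : 4 * K%:R * X <= 1.

Local Notation index := {ffun 'I_d -> 'I_K.*2.+1}.

(** By [XE] this is [n / sqrt (2k)]. *)
Let s := C * X `^ (d%:R / n%:R).

Lemma spacing_gt0 : 0 < s.
Proof. by have [C0 _] := AC; rewrite mulr_gt0 // powR_gt0. Qed.

(* The factor 2 comes from [|cos (2 pi x)|] having period [1/2]. *)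
Definition scaled_dist (h : index) i : R :=
  distZ (2 * matvecZ A (freq h) i) / s.

Lemma scaled_dist_ge0 (h : index) i : 0 <= scaled_dist h i.
Proof. by have /andP[z _] := distZ_bounds (2 * matvecZ A (freq h) i); rewrite divr_ge0 // ltW ?spacing_gt0. Qed.

Lemma scaled_dist_separated (h h' : index) : h != h' -> exists i,
  (fracR (2 * matvecZ A (freq h) i) <= 2^-1) != (fracR (2 * matvecZ A (freq h') i) <= 2^-1) \/
  1 <= `|scaled_dist h i - scaled_dist h' i|.
Proof.
move=> /freq_neq[l hl].
(* The vector has norm at most [4K <= 1 / X], and [C / B ^ (d/n)] at [B = 1 / X] is [s]. *)
have [||i] := @approx_const_exists (fun l => 2 * (freq h l - freq h' l)) X^-1.
- by exists l; rewrite mulf_neq0.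
- apply: supnormZ_le => [|m]; first by rewrite invr_ge0 ltW.
  rewrite -[X^-1]mul1r ler_pdivlMr // (le_trans _ KX) // ler_wpM2r ?(ltW X_gt0) //.
  rewrite intrM normrM intrB normr_nat.
  have := ler_normB (freq h m)%:~R ((freq h' m)%:~R : R).
  by have := freq_norm R h m; have := freq_norm R h' m; lra.
rewrite (matvecZ2 (fun l => freq h l - freq h' l)) matvecZB mulrBr.
rewrite -(powR_inv1 (ltW X_gt0)) powRAC powR_inv1 ?powR_ge0 // invrK -/s.
move=> lt_s; exists i; case: eqVneq => [sg|]; last by left.
right; have := lt_le_trans lt_s (distZ_sub sg).
rewrite -mulrBl normrM normfV (gtr0_norm spacing_gt0) ler_pdivlMr ?spacing_gt0 // mul1r.
exact: ltW.
Qed.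

(** The constant is [(4k / n) s^2 = 2n]. *)
Lemma walk_char_pow_le (h : index) :
  `|walk_char (freq h)| ^+ k <= expR (- (2 * n%:R * \sum_i scaled_dist h i ^+ 2)).
Proof.
have nR : n%:R != 0 :> R by rewrite pnatr_eq0 -lt0n.
have kR : k%:R != 0 :> R by rewrite pnatr_eq0 -lt0n.
apply: (@le_trans _ _ (expR (- (4 / n%:R * \sum_i distZ (2 * matvecZ A (freq h) i) ^+ 2)) ^+ k)).
  by rewrite lerXn2r ?nnegrE ?expR_ge0 // walk_char_le.
rewrite -expRM_natl ler_expR mulrN lerN2 le_eqVlt; apply/orP; left; apply/eqP.
rewrite [RHS]mulrA !mulr_sumr; apply: eq_bigr => i _.
rewrite /scaled_dist expr_div_n /s XE.
by field; rewrite nR kR.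
Qed.

(* The last step is [u <= exp ((u^2 - 1) / 2)]. *)
Lemma scaled_dist_far (h : index) : h != freq0 d K ->
  exists i, 1 <= scaled_dist h i /\
    (2 * X * supnormZ R (freq h))^-1 <= expR (n%:R * (scaled_dist h i ^+ 2 - 1) / 2).
Proof.
move=> /freq_neq[l]; rewrite freq_freq0 subr0 => hl.
have N1 := supnormZ_ge1 hl; set N := supnormZ R _ in N1 *.
have N0 : 0 < N by apply: lt_le_trans N1.
have NK : N <= K%:R by apply: supnormZ_le => // m; apply: freq_norm.
pose y := 2 * X * N.
have y0 : 0 < y by rewrite /y !mulr_gt0.
have y1 : y <= 1 by have := ler_wpM2l (ltW X_gt0) NK; have := KX; rewrite /y; have := X_gt0; lra.
have nR : 0 < n%:R :> R by rewrite ltr0n.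
have dR : 0 < d%:R :> R by rewrite ltr0n.
have e0 : 0 < d%:R / n%:R :> R by rewrite divr_gt0.
(* Since [2N = y / X], the distance obtained exceeds [s y ^ (- d/n)]. *)
have [||i] := @approx_const_exists (fun l => 2 * freq h l) (2 * N).
- by exists l; rewrite mulf_neq0.
- apply: supnormZ_le => [|m]; first by rewrite mulr_ge0 // ltW.
  by rewrite intrM normrM normr_nat ler_wpM2l // supnormZ_ge.
rewrite matvecZ2 => far; exists i.
have V : (y^-1) `^ (d%:R / n%:R) <= scaled_dist h i.
  rewrite /scaled_dist ler_pdivlMr ?spacing_gt0 //.
  apply: le_trans (ltW far); rewrite le_eqVlt; apply/orP; left; apply/eqP.
  have -> : 2 * N = y * X^-1 by rewrite /y; field; rewrite gt_eqF.
  rewrite powRM ?(ltW y0) ?invr_ge0 ?(ltW X_gt0) //.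
  rewrite -(powR_inv1 (ltW y0)) -(powR_inv1 (ltW X_gt0)) ![(_ `^ (-1)) `^ _]powRAC.
  by rewrite !powR_inv1 ?powR_ge0 // /s invfM invrK; ring.
have yV1 : 1 <= y^-1 by rewrite invf_ge1.
have V1 : 1 <= (y^-1) `^ (d%:R / n%:R).
  rewrite -[X in X <= _](_ : 1 `^ (d%:R / n%:R) = 1); last by rewrite powR1.
  by apply: ge0_ler_powR; rewrite ?nnegrE ?invr_ge0 // ltW.
have u1 : 1 <= scaled_dist h i by apply: le_trans V.
split => //; rewrite -/y.
have -> : y^-1 = ((y^-1) `^ (d%:R / n%:R)) `^ (n%:R / d%:R).
  rewrite -powRrM (_ : _ * _ = 1) ?powRr1 ?invr_ge0 ?(ltW y0) //.
  by field; rewrite !gt_eqF.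
apply: (@le_trans _ _ (scaled_dist h i `^ (n%:R / d%:R))).
  by apply: ge0_ler_powR; rewrite ?nnegrE ?powR_ge0 ?scaled_dist_ge0 // ltW // divr_gt0.
(* The exponent [n / d] may be raised to [n] because the base is at least 1. *)
apply: (@le_trans _ _ (scaled_dist h i `^ n%:R)).
  rewrite ler_powR // ler_pdivrMr // ler_peMr ?ler1n // ltW //.
rewrite powR_mulrn ?scaled_dist_ge0 // -mulrA expRM_natl lerXn2r ?nnegrE ?expR_ge0 ?scaled_dist_ge0 //.
apply: le_trans (expR_ge1Dx _).
by have := sqr_ge0 (scaled_dist h i - 1); lra.
Qed.

Definition packing_weight (h : index) : R :=
  expR (- (n%:R / 2)) * \prod_i expR (- (3 / 2 * n%:R)) ^+ Num.truncn (scaled_dist h i).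

(** Let [S] be the sum of the squares of the scaled distances. Of the exponent [2nS], at most
    [nS / 2] is spent on absorbing [1 / (2X|h|)], which also yields the factor [exp (-n/2)]; the
    remaining [3nS / 2] dominates the truncations, as [m <= m^2] for natural [m]. *)
Lemma walk_char_weight_le (h : index) : h != freq0 d K ->
  `|walk_char (freq h)| ^+ k <= 2 * X * supnormZ R (freq h) * packing_weight h.
Proof.
move=> hN0; have [i [u1 yE]] := scaled_dist_far hN0.
have [l] := freq_neq hN0; rewrite freq_freq0 subr0 => hl.
have N0 : 0 < supnormZ R (freq h) by apply: lt_le_trans (supnormZ_ge1 hl).
have y0 : 0 < 2 * X * supnormZ R (freq h) by rewrite !mulr_gt0.
rewrite -ler_pdivrMl //.
apply: le_trans (ler_pM _ _ yE (walk_char_pow_le h)) _.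
- by rewrite invr_ge0 ltW.
- by rewrite exprn_ge0.
rewrite -expRD /packing_weight.
have -> : \prod_j expR (- (3 / 2 * n%:R)) ^+ Num.truncn (scaled_dist h j) =
   expR (- (3 / 2 * n%:R * \sum_j (Num.truncn (scaled_dist h j))%:R)) :> R.
  rewrite mulr_sumr -sumrN expR_sum; apply: eq_bigr => j _.
  by rewrite -expRM_natr mulNr.
rewrite -expRD ler_expR.
set S := \sum_j scaled_dist h j ^+ 2; set T := \sum_j _.
have uS : scaled_dist h i ^+ 2 <= S.
  by rewrite /S (bigD1 i) //= lerDl sumr_ge0 // => j _; rewrite sqr_ge0.
have TS : T <= S.
  apply: ler_sum => j _; have u0 := scaled_dist_ge0 h j.
  have /andP[tu _] := truncn_itv u0.
  have : (Num.truncn (scaled_dist h j))%:R <= (Num.truncn (scaled_dist h j))%:R ^+ 2 :> R.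
    by rewrite -natrX ler_nat; case: (Num.truncn _) => // m; rewrite leq_pmulr.
  by move=> /le_trans; apply; rewrite ler_sqr ?nnegrE.
have nR : 0 <= n%:R :> R by [].
by nra.
Qed.

Lemma packing_weight_sum : \sum_(h | h != freq0 d K) packing_weight h <= 19 / 50.
Proof.
apply: le_trans (packing_bound_le _ n_gt0).
rewrite -mulr_sumr ler_wpM2l ?expR_ge0 //.
refine (@packing_sum R n _ (freq0 d K) scaled_dist (fun (g : index) i => fracR (2 * matvecZ A (freq g) i) <= 2^-1) (expR (- (3 / 2 * n%:R))) _ _ _ _).
- by rewrite expR_ge0 expR_lt1 oppr_lt0 mulr_gt0 ?ltr0n // divr_gt0.
- exact: scaled_dist_ge0.
- exact: scaled_dist_separated.
- by move=> h /scaled_dist_far[i [u1 _]]; exists i.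
Qed.

Lemma packing_weight_ge0 (h : index) : 0 <= packing_weight h.
Proof. by rewrite mulr_ge0 ?expR_ge0 // prodr_ge0 // => i _; rewrite exprn_ge0 ?expR_ge0. Qed.

End WalkCharacters.

(** * Fourier expansion of the smoothed indicator *)

Section FourierCoefficients.
Variable R : realType.
Variables a b : R.
Local Open Scope complex_scope.

(** The integral of [cis (- m x)] over [[a, b]]. *)
Definition interval_coef (m : R) : R[i] :=
  if m == 0 then (b - a)%:C
  else (cis (- (m * a)) - cis (- (m * b))) * (0 -i* (2 * pi * m)^-1).

Lemma interval_coefE m x : interval_coef m * cis (m * x) =
  (cos_primitive m (x - a) - cos_primitive m (x - b)) +i*
  (if m == 0 then 0 else (cos (2 * pi * (m * (x - b))) - cos (2 * pi * (m * (x - a)))) / (2 * pi * m)).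
Proof.
rewrite /interval_coef /cos_primitive; case: eqP => [->|_].
  rewrite mul0r cis0 mulr1; apply/eqP; rewrite eq_complex /= eqxx andbT.
  by apply/eqP; ring.
rewrite mulrAC mulrBl -!cisD !(addrC (- _)) -!mulrBr /cis.
by apply/eqP; rewrite eq_complex /=; apply/andP; split; apply/eqP; ring.
Qed.

Lemma normc_interval_coef m : `|m| * normc (interval_coef m) <= 1.
Proof.
rewrite /interval_coef; case: eqP => [->|/eqP m0]; first by rewrite normr0 mul0r ler01.
have p3 := @pi_ge3 R; have m0' : 0 < `|m| by rewrite normr_gt0.
rewrite normcM.
have -> : normc (0 -i* (2 * pi * m)^-1) = (2 * pi * `|m|)^-1.
  rewrite /= expr0n add0r sqrrN sqrtr_sqr normfV !normrM normr_nat.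
  by rewrite [`|pi|]gtr0_norm // pi_gt0.
have : normc (cis (- (m * a)) - cis (- (m * b))) <= 2.
  apply: le_trans (le_normcD _ _) _; rewrite normcN !normc_cis; lra.
move=> H; rewrite mulrCA.
have -> : `|m| * (2 * pi * `|m|)^-1 = (2 * pi)^-1.
  by rewrite invfM mulrCA divff ?mulr1 // gt_eqF.
rewrite ler_pdivrMr ?mulr_gt0 ?pi_gt0 // mul1r; apply: le_trans H _; lra.
Qed.

Variable K : nat.
Local Notation c := (@triangle_weight R K./2).
Local Notation Z := (\sum_p c p ^+ 2).
Local Notation index := ('I_(K./2).*2.+1 * 'I_(K./2).*2.+1)%type.

(** The difference [p - q] shifted by [K]; both indices are at most [K], so neither the subtraction
    nor [inord] truncates. *)
Let lag (pq : index) : 'I_K.*2.+1 := inord (pq.1 + K - pq.2).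

Lemma lagE pq : (lag pq + pq.2 = pq.1 + K)%N.
Proof.
have := ltn_ord pq.1; have := ltn_ord pq.2; move=> H1 H2.
by rewrite /lag inordK; lia.
Qed.

Lemma lagR pq : (lag pq)%:R - K%:R = pq.1%:R - pq.2%:R :> R.
Proof. by have := congr1 (fun t : nat => t%:R : R) (lagE pq); rewrite /= !natrD; lra. Qed.

Definition lag_weight (j : 'I_K.*2.+1) : R := (\sum_(pq | lag pq == j) c pq.1 * c pq.2) / Z.

(** Use [2 c_p c_q <= c_p^2 + c_q^2]: at a fixed lag each of [p] and [q] determines the other, so
    each sum of squares is at most [Z]. *)
Lemma lag_weight_le1 j : 0 <= lag_weight j <= 1.
Proof.
have Z0 := triangle_weight_energy_gt0 R K./2.
have c0 p : 0 <= c p by rewrite /triangle_weight.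
apply/andP; split; first by rewrite divr_ge0 ?(ltW Z0) // sumr_ge0 // => pq _; rewrite mulr_ge0.
rewrite ler_pdivrMr // mul1r.
apply: (@le_trans _ _ (\sum_(pq | lag pq == j) (c pq.1 ^+ 2 + c pq.2 ^+ 2) / 2)).
  by apply: ler_sum => pq _; have := sqr_ge0 (c pq.1 - c pq.2); lra.
rewrite -mulr_suml big_split /=.
have bound (f : index -> 'I_(K./2).*2.+1) : {in [pred pq | lag pq == j] &, injective f} ->
    \sum_(pq | lag pq == j) c (f pq) ^+ 2 <= Z.
  move=> finj; rewrite -(big_imset (fun p => c p ^+ 2) (h := f) (A := [pred pq | lag pq == j])) //=.
  rewrite [X in _ <= X](bigID (mem (f @: [pred pq | lag pq == j]))) /= lerDl.
  by apply: sumr_ge0 => p _; rewrite sqr_ge0.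
have B1 : \sum_(pq | lag pq == j) c pq.1 ^+ 2 <= Z.
  apply: (bound (fun pq => pq.1)) => -[p q] [p' q']; rewrite !inE /= => /eqP e1 /eqP e2 pp.
  have := lagE (p, q); have := lagE (p', q'); rewrite e1 e2 /= pp => E1 E2.
  by congr (_, _); apply/val_inj => /=; lia.
have B2 : \sum_(pq | lag pq == j) c pq.2 ^+ 2 <= Z.
  apply: (bound (fun pq => pq.2)) => -[p q] [p' q']; rewrite !inE /= => /eqP e1 /eqP e2 pp.
  have := lagE (p, q); have := lagE (p', q'); rewrite e1 e2 /= pp => E1 E2.
  by congr (_, _); apply/val_inj => /=; lia.
lra.
Qed.

Lemma lag_weight0 : lag_weight (inord K) = 1.
Proof.
have Z0 := triangle_weight_energy_gt0 R K./2.
rewrite /lag_weight -[RHS](divff (lt0r_neq0 Z0)); congr (_ / _).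
rewrite (reindex_onto (fun p : 'I_(K./2).*2.+1 => (p, p)) (fun pq => pq.1)) /=; last first.
  move=> [p q] /= /eqP e; congr (_, _); apply/val_inj => /=.
  have := lagE (p, q); rewrite e inordK /=; lia.
apply: eq_big => [p|p _]; last by rewrite expr2.
rewrite eqxx andbT; apply/eqP/val_inj => /=.
by have := lagE (p, p); rewrite inordK /=; lia.
Qed.

Definition smooth_coef (j : 'I_K.*2.+1) : R[i] :=
  (lag_weight j)%:C * interval_coef (j%:R - K%:R).

Lemma smooth_indicator_fourier x :
  (smooth_indicator K a b x)%:C = \sum_j smooth_coef j * cis ((j%:R - K%:R) * x).
Proof.
have Z0 := triangle_weight_energy_gt0 R K./2.
pose T m := interval_coef m * cis (m * x).
have -> : \sum_j smooth_coef j * cis ((j%:R - K%:R) * x) =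
    \sum_p \sum_q (c p * c q / Z)%:C * T (p%:R - q%:R).
  rewrite pair_big /= (partition_big lag xpredT) //=; apply: eq_bigr => j _.
  rewrite /smooth_coef -mulrA -/(T _) /lag_weight mulr_suml rmorph_sum mulr_suml /=.
  by apply: eq_bigr => pq /eqP <-; rewrite lagR.
have TE m : T m = (complex.Re (T m)) +i* (complex.Im (T m)) by case: (T m).
have ReT m : complex.Re (T m) = cos_primitive m (x - a) - cos_primitive m (x - b).
  by rewrite /T interval_coefE.
have ImT m : complex.Im (T (- m)) = - complex.Im (T m).
  rewrite /T !interval_coefE /= oppr_eq0; case: ifP => _; first by rewrite oppr0.
  by rewrite !mulNr !mulrN !cosN invrN mulrN.
have ReM r (z : R[i]) : complex.Re (r%:C * z) = r * complex.Re z.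
  by case: z => u v /=; rewrite mul0r subr0.
have ImM r (z : R[i]) : complex.Im (r%:C * z) = r * complex.Im z.
  by case: z => u v /=; rewrite mul0r addr0.
apply/eqP; rewrite eq_complex /=; apply/andP; split; apply/eqP.
  rewrite Re_sum /smooth_indicator /smoothing_cdf -mulrBl -sumrB mulr_suml.
  apply: eq_bigr => p _; rewrite Re_sum -sumrB mulr_suml; apply: eq_bigr => q _.
  by rewrite ReM ReT; ring.
rewrite Im_sum (eq_bigr _ (fun p _ => Im_sum _ _ _)).
(* Exchanging [p] and [q] negates the frequency, under which the imaginary part is odd. *)
set S := \sum_p _; suff : S = - S by lra.
rewrite {1}/S exchange_big /= -sumrN; apply: eq_bigr => p _; rewrite -sumrN.
apply: eq_bigr => q _.
by rewrite !ImM -[q%:R - p%:R]opprB ImT; ring.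
Qed.

Hypothesis ab : 0 <= b - a <= 1.

Lemma smooth_coef_le1 j : normc (smooth_coef j) <= 1.
Proof.
have /andP[g0 g1] := lag_weight_le1 j.
rewrite normcM normcR ger0_norm //.
suff : normc (interval_coef (j%:R - K%:R)) <= 1.
  have := normc_ge0 (interval_coef (j%:R - K%:R)); move: (normc _) (lag_weight j) g0 g1 => u v; nra.
have [e|ne] := eqVneq (j : nat) K.
  by case/andP: ab => ab0 ab1; rewrite e subrr /interval_coef eqxx normcR ger0_norm.
apply: le_trans (normc_interval_coef (j%:R - K%:R)).
rewrite ler_peMl ?normc_ge0 //.
have [jK|Kj|] := ltngtP j K; last by move/eqP; rewrite (negbTE ne).
  by rewrite distrC ger0_norm ?subr_ge0 ?ler_nat ?(ltnW jK) // -natrB ?(ltnW jK) // ler1n subn_gt0.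
by rewrite ger0_norm ?subr_ge0 ?ler_nat ?(ltnW Kj) // -natrB ?(ltnW Kj) // ler1n subn_gt0.
Qed.

Lemma smooth_coef_decay (j : 'I_K.*2.+1) : `|j%:R - K%:R| * normc (smooth_coef j) <= 1.
Proof.
have /andP[g0 g1] := lag_weight_le1 j.
rewrite normcM normcR (ger0_norm g0) mulrCA.
have := normc_interval_coef (j%:R - K%:R).
have : 0 <= `|j%:R - K%:R| * normc (interval_coef (j%:R - K%:R)) by rewrite mulr_ge0 // normc_ge0.
move: (_ * normc _) (lag_weight j) g0 g1 => u v; nra.
Qed.

Lemma smooth_coef0 : smooth_coef (inord K) = (b - a)%:C.
Proof.
rewrite /smooth_coef lag_weight0 inordK ?subrr; last by lia.
by rewrite /interval_coef eqxx mul1r.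
Qed.

End FourierCoefficients.

(** * Averages of characters over the walk *)

Section WalkAverages.
Variable R : realType.
Variables (n d k : nat) (A : 'M[R]_(n, d)).
Hypothesis n_gt0 : (0 < n)%N.
Local Open Scope complex_scope.
Local Notation steps := {ffun 'I_k -> 'I_n * bool}.

(** A character is multiplicative over the steps, so the sum over step sequences is the [k]-th power
    of a sum over one step. *)
Lemma walk_char_sum (h : 'I_d -> int) :
  \sum_(w : steps) cis (\sum_l (h l)%:~R * walk_point A w l) =
  (((2 * n) ^ k)%:R * walk_char A h ^+ k)%:C.
Proof.
pose G (x : 'I_n * bool) := cis (if x.2 then matvecZ A h x.1 else - matvecZ A h x.1).
have -> : \sum_(w : steps) cis (\sum_l (h l)%:~R * walk_point A w l) = \sum_(w : steps) \prod_j G (w j).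
  apply: eq_bigr => w _; rewrite /G -cis_sum; congr cis.
  rewrite /walk_point; under eq_bigr do rewrite mulr_sumr.
  rewrite exchange_big /=; apply: eq_bigr => j _.
  case: (w j) => i [] /=; rewrite /matvecZ; last rewrite -sumrN.
    by apply: eq_bigr => l _; rewrite mulrC.
  by apply: eq_bigr => l _; rewrite mulrN mulrC.
rewrite -(bigA_distr_bigA (fun (_ : 'I_k) x => G x)) prodr_const card_ord natrX -exprMn rmorphXn /=; congr (_ ^+ _).
rewrite /G -(pair_big xpredT xpredT (fun i (s : bool) => cis (if s then matvecZ A h i else - matvecZ A h i))) /=.
have -> : (2 * n)%:R * walk_char A h = \sum_i 2 * cos (2 * pi * matvecZ A h i).
  rewrite /walk_char natrM -mulr_sumr; field.
  by rewrite pnatr_eq0 -lt0n.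
rewrite rmorph_sum; apply: eq_bigr => i _; rewrite big_bool /= /cis mulrN cosN sinN.
by apply/eqP; rewrite eq_complex /=; apply/andP; split; apply/eqP; ring.
Qed.

Lemma walk_char0 : walk_char A (fun=> 0) = 1.
Proof.
rewrite /walk_char (eq_bigr (fun=> 1)) => [|i _]; last first.
  by rewrite /matvecZ big1 ?mulr0 ?cos0 // => l _; rewrite mulr0.
by rewrite sumr_const card_ord divff // pnatr_eq0 -lt0n.
Qed.

Definition walk_mean (F : ('I_d -> R) -> R) : R :=
  (\sum_(w : steps) F (walk_point A w)) / ((2 * n) ^ k)%:R.

Lemma steps_gt0 : 0 < ((2 * n) ^ k)%:R :> R.
Proof. by rewrite ltr0n expn_gt0 muln_gt0 n_gt0. Qed.

Lemma walk_mean_cos (h : 'I_d -> int) (t : R) :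
  walk_mean (fun x => cos (2 * pi * (\sum_l (h l)%:~R * x l - t))) =
  cos (2 * pi * t) * walk_char A h ^+ k.
Proof.
rewrite /walk_mean; have W0 := steps_gt0.
have -> : \sum_(w : steps) cos (2 * pi * (\sum_l (h l)%:~R * walk_point A w l - t)) =
  complex.Re (cis (- t) * \sum_(w : steps) cis (\sum_l (h l)%:~R * walk_point A w l)).
  rewrite mulr_sumr Re_sum; apply: eq_bigr => w _.
  by rewrite -cisD addrC.
rewrite walk_char_sum /= mulrN cosN mulr0 subr0; field.
by rewrite gt_eqF.
Qed.

End WalkAverages.

(** Factors are replaced one at a time; this passes from the sides of a box to the box. *)
Lemma prod_sub_le (R : realDomainType) (I : Type) (r : seq I) (u v : I -> R) :
  (forall i, 0 <= u i <= 1) -> (forall i, 0 <= v i <= 1) ->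
  `|\prod_(i <- r) u i - \prod_(i <- r) v i| <= \sum_(i <- r) `|u i - v i|.
Proof.
move=> u01 v01; elim: r => [|i r IHr]; first by rewrite !big_nil subrr normr0.
rewrite !big_cons; have /andP[u0 u1] := u01 i.
have V : 0 <= \prod_(j <- r) v j <= 1.
  elim: r {IHr} => [|j r /andP[p0 p1]]; rewrite ?big_nil ?ler01 ?lexx // big_cons.
  by have /andP[v0 v1] := v01 j; rewrite mulr_ge0 //= mulr_ile1.
move: (\prod_(j <- r) u j) (\prod_(j <- r) v j) IHr V => U V IHr /andP[V0 V1].
have -> : u i * U - v i * V = (u i - v i) * V + u i * (U - V) by ring.
apply: le_trans (ler_normD _ _) _; rewrite !normrM (ger0_norm V0) (ger0_norm u0).
apply: lerD; first by rewrite ler_piMr.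
by apply: le_trans IHr; rewrite ler_piMl.
Qed.

(** * The discrepancy bound in terms of Fourier coefficients *)

Section Discrepancy.
Variable R : realType.
Variables (n d k K : nat) (A : 'M[R]_(n, d)).
Hypothesis n_gt0 : (0 < n)%N.
Local Open Scope complex_scope.
Local Notation index := {ffun 'I_d -> 'I_K.*2.+1}.
Local Notation mean := (walk_mean k A).
Local Notation wc := (walk_char A).

Lemma freqE (h : index) l : (freq h l)%:~R = (h l)%:R - K%:R :> R.
Proof. by rewrite /freq intrB. Qed.

Lemma freq_freq0E : freq (freq0 d K) = fun=> 0.
Proof. by apply/funext => l; rewrite freq_freq0. Qed.

Lemma walk_mean_le (F F' : ('I_d -> R) -> R) : (forall x, F x <= F' x) -> mean F <= mean F'.
Proof.
move=> FF; rewrite /walk_mean ler_wpM2r ?invr_ge0 ?(ltW (steps_gt0 R k n_gt0)) //.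
exact: ler_sum.
Qed.

Lemma walk_mean_norm (F : ('I_d -> R) -> R) : `|mean F| <= mean (fun x => `|F x|).
Proof.
have S0 := steps_gt0 R k n_gt0.
by rewrite /walk_mean normrM normfV (gtr0_norm S0) ler_wpM2r ?invr_ge0 ?(ltW S0) // ler_norm_sum.
Qed.

Lemma walk_meanB (F F' : ('I_d -> R) -> R) : mean F - mean F' = mean (fun x => F x - F' x).
Proof. by rewrite /walk_mean -mulrBl -sumrB. Qed.

Lemma walk_mean_sum (I : Type) (r : seq I) (F : I -> ('I_d -> R) -> R) :
  mean (fun x => \sum_(i <- r) F i x) = \sum_(i <- r) mean (F i).
Proof. by rewrite /walk_mean exchange_big mulr_suml. Qed.

Lemma walk_meanZ (t : R) (F : ('I_d -> R) -> R) : mean (fun x => t * F x) = t * mean F.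
Proof. by rewrite /walk_mean -mulr_sumr mulrA. Qed.

Lemma Qconv_box_mean (a b : 'I_d -> R) :
  Qconv_box k A a b =
  mean (fun x => \prod_l ((a l <= fracR (x l)) && (fracR (x l) < b l))%R%:R).
Proof.
rewrite /Qconv_box /walk_mean; congr (_ / _).
rewrite -sum1_card natr_sum big_mkcond /=; apply: eq_bigr => w _.
rewrite inE /in_box; case: ifPn => [/fintype.forallP H|/fintype.forallPn[l /negbTE H]].
  by rewrite big1 // => l _; rewrite H.
by rewrite (bigD1 l) //= H mul0r.
Qed.

(** The zero frequency contributes the volume. At other frequencies all factors are at most 1, and
    the one in a largest coordinate is at most [1 / |h|]. *)
Lemma smooth_mean_le (a b : 'I_d -> R) : (forall l, 0 <= b l - a l <= 1) ->
  `|mean (fun x => \prod_l smooth_indicator K (a l) (b l) (x l)) - haar_box a b| <=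
  \sum_(h | h != freq0 d K) (supnormZ R (freq h))^-1 * `|wc (freq h)| ^+ k.
Proof.
move=> ab; have S0 := steps_gt0 R k n_gt0.
pose g l := smooth_coef (a l) (b l) (K := K).
set M := mean _; have E : M%:C =
    \sum_(h : index) \prod_l g l (h l) * (wc (freq h) ^+ k)%:C.
  apply: (mulIf (x := (((2 * n) ^ k)%:R : R)%:C)).
    by rewrite fmorph_eq0 gt_eqF.
  rewrite -rmorphM /= /M /walk_mean divfK ?gt_eqF // rmorph_sum /= mulr_suml.
  transitivity (\sum_(w : {ffun 'I_k -> 'I_n * bool}) \sum_(h : index)
      \prod_l g l (h l) * cis (\sum_l (freq h l)%:~R * walk_point A w l)).
    apply: eq_bigr => w _; rewrite rmorph_prod /=.
    under eq_bigr do rewrite smooth_indicator_fourier.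
    rewrite bigA_distr_bigA; apply: eq_bigr => h _.
    rewrite big_split /= cis_sum; congr (_ * _); apply: eq_bigr => l _.
    by rewrite freqE.
  rewrite exchange_big; apply: eq_bigr => h _; rewrite -mulr_sumr walk_char_sum //.
  by rewrite -mulrA -rmorphM mulrC [in RHS]mulrC [X in X%:C * _ = _]mulrC.
have H0 : (haar_box a b)%:C = \prod_l g l (freq0 d K l) * (wc (freq (freq0 d K)) ^+ k)%:C.
  rewrite freq_freq0E walk_char0 // expr1n mulr1 /haar_box rmorph_prod; apply: eq_bigr => l _.
  by rewrite ffunE /g smooth_coef0.
have MB : (M - haar_box a b)%:C = M%:C - (haar_box a b)%:C := rmorphB _ _ _.
rewrite -normcR MB E H0 (bigD1 (freq0 d K)) //= addrAC subrr add0r.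
apply: le_trans (normc_sum _ _ _) _; apply: ler_sum => h hN0.
rewrite normcM normcR normc_prod normrX ler_wpM2r ?exprn_ge0 //.
have [l0] := freq_neq hN0; rewrite freq_freq0 subr0 => /(@supnormZ_ge1 R) N1.
have N0 : 0 < supnormZ R (freq h) by apply: lt_le_trans N1.
rewrite -[X in _ <= X]mul1r ler_pdivlMr // mulrC.
have g0 l : 0 <= normc (g l (h l)) <= 1 by rewrite normc_ge0 smooth_coef_le1.
set P := \prod_l _.
have P0 : 0 <= P by apply: prodr_ge0 => l _; case/andP: (g0 l).
(* With [P] invertible, the claim becomes a bound on the sup norm, checked coordinate by
   coordinate. *)
have [->|PN0] := eqVneq P 0; first by rewrite mulr0 ler01.
have {}P0 : 0 < P by rewrite lt_def PN0.
rewrite -ler_pdivlMr // mul1r; apply: supnormZ_le => [|l]; first by rewrite invr_ge0 ltW.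
rewrite -[P^-1]mul1r ler_pdivlMr // freqE.
apply: le_trans (smooth_coef_decay (a l) (b l) (h l)).
rewrite ler_wpM2l // /P (bigD1 l) //= ler_piMr ?normc_ge0 //.
by apply: prodr_ile1 => i _; apply: g0.
Qed.

Lemma majorantE (v : R) : majorant K.+1 v = (\sum_(p < K.+1) \sum_(q < K.+1)
  (1 + cos (2 * pi * ((p%:R - q%:R) * (2 * K.+1%:R)^-1))) * cos (2 * pi * ((p%:R - q%:R) * v))) / K.+1%:R ^+ 2.
Proof.
rewrite /majorant /fejer -!mulrDl -mulrA [_^-1 / 2]mulrC mulrA -mulrDl; congr (_ / _).
rewrite -!big_split mulr_suml -big_split; apply: eq_bigr => p _ /=.
rewrite -!big_split mulr_suml -big_split; apply: eq_bigr => q _ /=.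
rewrite !mulrDr !mulrN cosB cosD; move: (2 * K.+1%:R)^-1 => t; by field.
Qed.

(** For fixed [p], distinct [q] give distinct frequencies along axis [l], so each of the [K + 1]
    rows is at most twice the sum over all frequencies; the 1 is the zero frequency. *)
Lemma majorant_mean_le (l : 'I_d) (t : R) :
  mean (fun x => majorant K.+1 (x l - t)) <=
  2 / K.+1%:R * (1 + \sum_(h | h != freq0 d K) `|wc (freq h)| ^+ k).
Proof.
set S := 1 + _; pose N : R := K.+1%:R.
have N0 : 0 < N by rewrite ltr0n.
pose h (p q : 'I_K.+1) : index := [ffun l' => if l' == l then inord (p + K - q) else inord K].
have hE p q x : \sum_l' (freq (h p q) l')%:~R * x l' = (p%:R - q%:R) * x l :> R.
  rewrite (bigD1 l) //= big1 ?addr0 => [|l' ne].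
    have pl := ltn_ord p; have ql := ltn_ord q.
    rewrite freqE ffunE eqxx inordK; last by lia.
    by rewrite natrB ?natrD; [congr (_ * _); ring | lia].
  by rewrite freqE ffunE (negbTE ne) inordK ?subrr ?mul0r //; lia.
have row p : \sum_q `|wc (freq (h p q))| ^+ k <= S.
  have inj : injective (h p).
    move=> q q' /ffunP/(_ l); rewrite !ffunE eqxx => /(congr1 val) /=.
    have pl := ltn_ord p; have ql := ltn_ord q; have ql' := ltn_ord q'.
    by rewrite !inordK; [move=> e; apply/val_inj => /=; lia | lia | lia].
  have -> : S = \sum_(g : index) `|wc (freq g)| ^+ k.
    by rewrite (bigD1 (freq0 d K)) //= freq_freq0E walk_char0 // normr1 expr1n.
  rewrite -(big_imset (fun g => `|wc (freq g)| ^+ k) (h := h p) (A := 'I_K.+1)) //=; last first.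
    by move=> ? ? _ _; apply: inj.
  rewrite [X in _ <= X](bigID (mem (h p @: 'I_K.+1))) /= lerDl.
  by apply: sumr_ge0 => g _; rewrite exprn_ge0.
have -> : mean (fun x => majorant K.+1 (x l - t)) = (\sum_(p < K.+1) \sum_(q < K.+1)
    (1 + cos (2 * pi * ((p%:R - q%:R) * (2 * N)^-1))) *
    (cos (2 * pi * ((p%:R - q%:R) * t)) * wc (freq (h p q)) ^+ k)) / N ^+ 2.
  have -> : (fun x : 'I_d -> R => majorant K.+1 (x l - t)) = (fun x => N ^- 2 * \sum_(p < K.+1) \sum_(q < K.+1)
     (1 + cos (2 * pi * ((p%:R - q%:R) * (2 * N)^-1))) * cos (2 * pi * ((p%:R - q%:R) * (x l - t)))).
    by apply/funext => x; rewrite majorantE mulrC.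
  rewrite walk_meanZ walk_mean_sum mulrC; congr (_ / _); apply: eq_bigr => p _.
  rewrite walk_mean_sum; apply: eq_bigr => q _; rewrite walk_meanZ; congr (_ * _).
  rewrite -walk_mean_cos //; congr (walk_mean k A _); apply/funext => x.
  by rewrite hE mulrBr.
rewrite ler_pdivrMr ?exprn_gt0 //.
have -> : 2 / N * S * N ^+ 2 = \sum_(p < K.+1) 2 * S.
  rewrite sumr_const card_ord -[RHS]mulr_natr -/N; move: N N0 S {row} => y y0 z.
  by field; rewrite gt_eqF.
apply: ler_sum => p _; apply: (@le_trans _ _ (\sum_q 2 * `|wc (freq (h p q))| ^+ k)); last first.
  by rewrite -mulr_sumr ler_wpM2l.
apply: ler_sum => q _; apply: le_trans (ler_norm _) _; rewrite normrM [X in _ * X]normrM normrX.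
apply: ler_pM => //; first by rewrite mulr_ge0 // exprn_ge0.
  by apply: le_trans (ler_normD _ _) _; rewrite normr1; have := cos_max (2 * pi * ((p%:R - q%:R) * (2 * N)^-1)); lra.
by rewrite ler_piMl ?exprn_ge0 // cos_max.
Qed.

Hypothesis K7 : (7 <= K)%N.

Lemma discrepancy_le (a b : 'I_d -> R) : is_box a b ->
  `|Qconv_box k A a b - haar_box a b| <=
  d%:R * (4 / K.+1%:R * (1 + \sum_(h | h != freq0 d K) `|wc (freq h)| ^+ k)) +
  \sum_(h | h != freq0 d K) (supnormZ R (freq h))^-1 * `|wc (freq h)| ^+ k.
Proof.
move=> box; rewrite Qconv_box_mean.
set F := fun x : 'I_d -> R => _.
pose G (x : 'I_d -> R) := \prod_l smooth_indicator K (a l) (b l) (x l).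
have -> : mean F - haar_box a b = (mean F - mean G) + (mean G - haar_box a b) by ring.
apply: le_trans (ler_normD _ _) _; apply: lerD; last first.
  by apply: smooth_mean_le => l; have [a0 [ab b1]] := box l; apply/andP; split; lra.
rewrite walk_meanB; apply: le_trans (walk_mean_norm _) _.
apply: (@le_trans _ _ (mean (fun x => \sum_l (majorant K.+1 (x l - a l) + majorant K.+1 (x l - b l))))).
  apply: walk_mean_le => x; apply: le_trans (prod_sub_le _ _ _) _ => [l|l|].
  - by rewrite ler0n lern1 leq_b1.
  - by have [a0 [ab b1]] := box l; apply: smooth_indicator_itv; apply/andP; split; lra.
  - by apply: ler_sum => l _; have [a0 [ab b1]] := box l; apply: smooth_indicator_error.
rewrite walk_mean_sum; set B := _ * (1 + _).
have -> : d%:R * B = \sum_(l < d) B by rewrite sumr_const card_ord mulr_natl.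
apply: ler_sum => l _.
have -> : mean (fun x => majorant K.+1 (x l - a l) + majorant K.+1 (x l - b l)) =
  mean (fun x => majorant K.+1 (x l - a l)) + mean (fun x => majorant K.+1 (x l - b l)).
  by rewrite /walk_mean -mulrDl -big_split.
have := majorant_mean_le l (a l); have := majorant_mean_le l (b l).
rewrite /B; set S := 1 + _; move: (mean _) (mean _) => u v.
have -> : 4 / K.+1%:R * S = 2 / K.+1%:R * S + 2 / K.+1%:R * S :> R by ring.
by move=> *; apply: lerD.
Qed.

End Discrepancy.

(** * Numerical constants and conclusion *)

Lemma linear_le_exp (R : realFieldType) (d : nat) : (0 < d)%N ->
  2208 / 100 * d%:R + 76 / 100 <= (3 / 2) ^+ d * 20 :> R.
Proof.
(* The constants are [16 * (69/50)] and [2 * (19/50)], from the final estimate. At [d = 2] the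
   inequality reads [44.92 <= 45]; the induction starts there. *)
case: d => // -[_|d _]; first by lra.
elim: d => [|d IHd]; first by lra.
rewrite exprS -natr1; have : 2 <= d.+2%:R :> R by rewrite (ler_nat _ 2).
lra.
Qed.

Lemma Qconv_box_itv (R : realType) (n d k : nat) (A : 'M[R]_(n, d)) (a b : 'I_d -> R) :
  (0 < n)%N -> 0 <= Qconv_box k A a b <= 1.
Proof.
move=> n0; have S0 := steps_gt0 R k n0.
rewrite /Qconv_box divr_ge0 ?(ltW S0) //= ler_pdivrMr // mul1r ler_nat.
by apply: leq_trans (max_card _) _; rewrite card_ffun card_prod card_bool !card_ord mulnC.
Qed.

Lemma haar_box_itv (R : realType) (d : nat) (a b : 'I_d -> R) :
  is_box a b -> 0 <= haar_box a b <= 1.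
Proof.
move=> box; have ab l : 0 <= b l - a l <= 1 by have [a0 [ab b1]] := box l; apply/andP; split; lra.
rewrite /haar_box prodr_ile1 ?andbT; last by move=> l _; apply: ab.
by apply: prodr_ge0 => l _; case/andP: (ab l).
Qed.

Lemma scale_sqr (R : realType) (n d k : nat) (C : R) : (0 < n)%N -> (0 < d)%N -> (0 < k)%N -> 0 < C ->
  (C * (powR (n%:R / (C * Num.sqrt 2)) (n%:R / d%:R) * powR k%:R (- (n%:R / (2 * d%:R))))
    `^ (d%:R / n%:R)) ^+ 2 = n%:R ^+ 2 / (2 * k%:R).
Proof.
move=> n0 d0 k0 C0.
have nR : n%:R != 0 :> R by rewrite pnatr_eq0 -lt0n.
have dR : d%:R != 0 :> R by rewrite pnatr_eq0 -lt0n.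
have kR : k%:R != 0 :> R by rewrite pnatr_eq0 -lt0n.
have s2 : 0 < Num.sqrt 2 :> R by rewrite sqrtr_gt0.
rewrite powRM ?powR_ge0 // -!powRrM.
have -> : n%:R / d%:R * (d%:R / n%:R) = 1 :> R by field; rewrite nR dR.
have -> : - (n%:R / (2 * d%:R)) * (d%:R / n%:R) = - 2^-1 :> R by field; rewrite nR dR.
rewrite powRr1 ?divr_ge0 ?mulr_ge0 ?(ltW C0) ?(ltW s2) //.
rewrite powRN powR12_sqrt // !exprMn !exprVn !exprMn !sqr_sqrtr //.
by field; rewrite kR gt_eqF.
Qed.

(* D(Q^{*k}) <= bound, written as: |Q^{*k}(B) - U(B)| <= bound for every box B. *)
Theorem theorem2 (R : realType) (n d : nat) (A : 'M[R]_(n, d)) (C_A : R) :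
  (0 < d)%N -> (0 < n)%N -> approx_const A C_A ->
  forall k : nat, (0 < k)%N ->
  forall a b : 'I_d -> R, is_box a b ->
    `|Qconv_box k A a b - haar_box a b| <=
      (3 / 2) ^+ d * 20 * powR (n%:R / (C_A * Num.sqrt 2)) (n%:R / d%:R)
        * powR k%:R (- (n%:R / (2 * d%:R))).
Proof.
move=> d0 n0 AC k k0 a b box; have [C0 _] := AC.
have XE := scale_sqr n0 d0 k0 C0; rewrite -mulrA; move: XE.
set X := powR (n%:R / _) _ * powR k%:R _ => XE.
have X0 : 0 < X.
  apply: mulr_gt0; apply: powR_gt0; last by rewrite ltr0n.
  by rewrite divr_gt0 ?ltr0n // mulr_gt0 // sqrtr_gt0 ltr0n.
(* A discrepancy never exceeds 1. In the other case [X < 1/30], so [1 / (4X) > 7], whence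
   [K >= 7]. *)
have [trivial_bound|small] := leP 1 ((3 / 2) ^+ d * 20 * X).
  apply: le_trans trivial_bound; rewrite ler_norml.
  have /andP[q0 q1] := Qconv_box_itv k A a b n0; have /andP[h0 h1] := haar_box_itv box.
  by apply/andP; split; lra.
pose K := Num.truncn (4 * X)^-1.
have M0 : 0 <= (4 * X)^-1 by rewrite invr_ge0 mulr_ge0 // ltW.
have XM : 4 * X * (4 * X)^-1 = 1 by rewrite divff // mulf_neq0 // gt_eqF.
have /andP[KM MK] := truncn_itv M0; rewrite -/K in KM MK.
have K7 : (7 <= K)%N.
  rewrite truncn_ge_nat //.
  have d32 : 3 / 2 <= (3 / 2) ^+ d :> R.
    by rewrite -[X in X <= _]expr1 ler_weXn2l //; lra.
  by nra.
have KX : 4 * K%:R * X <= 1 by nra.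
have KX1 : (K.+1%:R)^-1 <= 4 * X :> R.
  have X4 : 0 < 4 * X by rewrite mulr_gt0.
  by rewrite -[4 * X]invrK lef_pV2 ?posrE ?invr_gt0 ?ltr0n //; apply: ltW.
apply: le_trans (discrepancy_le k A n0 K7 box) _.
have PS := packing_weight_sum n0 AC X0 d0 KX.
set PW := \sum_(h | h != freq0 d K) _ in PS.
have S1 : \sum_(h | h != freq0 d K) `|walk_char A (freq h)| ^+ k <= PW.
  apply: ler_sum => h hN0.
  apply: le_trans (walk_char_weight_le n0 AC X0 k0 d0 XE KX hN0) _.
  (* The prefactor [2X|h|] is at most [2XK <= 1]. *)
  rewrite ler_piMl ?packing_weight_ge0 //.
  have : supnormZ R (freq h) <= K%:R by apply: supnormZ_le => // l; apply: freq_norm.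
  by nra.
have S2 : \sum_(h | h != freq0 d K) (supnormZ R (freq h))^-1 * `|walk_char A (freq h)| ^+ k <= 2 * X * PW.
  rewrite mulr_sumr; apply: ler_sum => h hN0.
  have [l] := freq_neq hN0; rewrite freq_freq0 subr0 => /(@supnormZ_ge1 R) N1.
  have N0 : 0 < supnormZ R (freq h) by apply: lt_le_trans N1.
  rewrite ler_pdivrMl //.
  apply: le_trans (walk_char_weight_le n0 AC X0 k0 d0 XE KX hN0) _.
  by rewrite le_eqVlt; apply/orP; left; apply/eqP; ring.
have num := linear_le_exp R d0.
have dR : 0 <= d%:R :> R by [].
move: (\sum_(h | _) `|walk_char _ _| ^+ _) S1 => S S1.
move: (\sum_(h | _) _) S2 => S' S2.
(* From the packing bound [19/50]; with [1 / (K + 1) <= 4X] it makes the smoothing error at most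
   [d * 16 X * (69/50)]. *)
have S1' : 1 + S <= 69 / 50 by lra.
have B1 : 4 / K.+1%:R * (1 + S) <= 16 * X * (69 / 50).
  apply: (@le_trans _ _ (4 / K.+1%:R * (69 / 50))); first by rewrite ler_wpM2l // divr_ge0.
  by move: (K.+1%:R)^-1 KX1 => y; lra.
have B2 : d%:R * (4 / K.+1%:R * (1 + S)) <= d%:R * (16 * X * (69 / 50)) by rewrite ler_wpM2l.
have B3 : 2 * X * PW <= 2 * X * (19 / 50) by rewrite ler_wpM2l // mulr_ge0 // ltW.
have B4 : (2208 / 100 * d%:R + 76 / 100) * X <= (3 / 2) ^+ d * 20 * X by rewrite ler_wpM2r // ltW.
apply: le_trans (lerD B2 (le_trans S2 B3)) _; apply: le_trans B4; lra.
Qed.
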